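(* Let $0<\Phi<\pi/2$. Define the polar wedge $$W_\Phi=\{\xi\in\mathbb{R}^2:\ \xi=r(\cos\omega,\sin\omega),\ r\in\mathbb{R},\ |\omega|\le\Phi\},$$ and define a proper subset of the curvelet index set $\mathcal{I}$ by $$\mathcal{I}_\Phi^{\mathrm{invisible}}=\{(j,l,k)\in\mathcal{I}:\ \operatorname{supp}\hat\psi_{j,l,k}\cap W_\Phi=\emptyset\},$$ where $\psi_{j,l,k}$ denotes a curvelet. Then $$\mathcal{R}_\Phi\psi_{j,l,k}\equiv 0\quad\text{for all }(j,l,k)\in\mathcal{I}_\Phi^{\mathrm{invisible}}.$$
   Context: Fourier transform on $\mathbb{R}^2$: $\hat f(\xi)=(2\pi)^{-1}\int_{\mathbb{R}^2}f(x)e^{-ix\cdot\xi}\,dx$. Radon transform: $\mathcal{R}f(\theta,s)=\int_{L(\theta,s)}f(x)\,dS(x)$, where $L(\theta,s)=\{x\in\mathbb{R}^2: x_1\cos\theta+x_2\sin\theta=s\}$, $s\in\mathbb{R}$. The limited angle Radon transform $\mathcal{R}_\Phi f$ is $\mathcal{R}f$ regarded as a function on $[-\Phi,\Phi]\times\mathbb{R}$ only. Curvelets: Let $W$ (radial window, a function of $r$) and $V$ (angular window, a function of $\omega$) be real $C^\infty$ functions with $\operatorname{supp}W\subset(1/2,2)$, $\operatorname{supp}V\subset(-1,1)$, $\sum_{j=-\infty}^\infty W^2(2^jr)=1$ for $r\in(3/4,3/2)$ and $\sum_{l=-\infty}^\infty V^2(\omega-l)=1$ for $\omega\in(-1/2,1/2)$.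 For $j\in\mathbb{N}_0=\{0,1,2,\dots\}$ the generating curvelet $\psi_{j,0,0}$ is defined through its Fourier transform in polar coordinates $(r,\omega)$ ($r\ge 0$, polar angle $\omega\in[-\pi,\pi)$) by $$\widehat\psi_{j,0,0}(r,\omega)=2^{-3j/4}\,W(2^{-j}r)\,V\!\left(\frac{2^{\lceil j/2\rceil+1}}{\pi}\,\omega\right).$$ For $-2^{\lceil j/2\rceil+1}\le l<2^{\lceil j/2\rceil+1}$ and $k=(k_1,k_2)\in\mathbb{Z}^2$ put $\theta_{j,l}=l\,\pi\,2^{-\lceil j/2\rceil-1}$, $R_\eta=\begin{pmatrix}\cos\eta&\sin\eta\\-\sin\eta&\cos\eta\end{pmatrix}$, $b^{j,l}_k=R_{\theta_{j,l}}^{-1}(k_1/2^j,\,k_2/2^{j/2})^T$, and $$\psi_{j,l,k}(x)=\psi_{j,0,0}\big(R_{\theta_{j,l}}(x-b^{j,l}_k)\big).$$ The low-pass function $\psi_{-1,0,0}$ is defined by $\widehat\psi_{-1,0,0}(r,\omega)=W_0(r)$ with $W_0^2(r)=1-\sum_{j=0}^\infty W^2(2^{-j}r)$, and $\psi_{-1,0,k}$, $k\in\mathbb{Z}^2$, denote its translates (by $k$). The curvelet index set is $$\mathcal{I}=\{(-1,0,k):k\in\mathbb{Z}^2\}\cup\{(j,l,k):j\in\mathbb{N}_0,\ k\in\mathbb{Z}^2,\ -2^{\lceil j/2\rceil+1}\le l<2^{\lceil j/2\rceil+1}\}.$$ *)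

(* Defs.v *)
From HB Require Import structures.
From mathcomp Require Import all_boot all_order all_algebra.
From mathcomp Require Import complex.
From mathcomp Require Import all_classical all_reals all_analysis.

Set Implicit Arguments.
Unset Strict Implicit.
Unset Printing Implicit Defensive.

Import Order.TTheory GRing.Theory Num.Theory.
Import numFieldNormedType.Exports.

Local Open Scope classical_set_scope.
Local Open Scope ring_scope.
Local Open Scope complex_scope.

Section ComplexIntegral.
Context d (T : measurableType d) (R : realType).
Variable mu : {measure set T -> \bar R}.

Definition cintegrable (f : T -> R[i]) : Prop :=
  mu.-integrable setT (EFin \o (fun x => complex.Re (f x))) /\
  mu.-integrable setT (EFin \o (fun x => complex.Im (f x))).

Definition cintegral (f : T -> R[i]) : R[i] :=
  Rintegral mu setT (fun x => complex.Re (f x)) +i*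
  Rintegral mu setT (fun x => complex.Im (f x)).

End ComplexIntegral.

Section Curvelets.
Variable R : realType.

Definition lebesgue2 :
  {measure set (measurableTypeR R * measurableTypeR R) -> \bar R} :=
  (@lebesgue_measure R \x @lebesgue_measure R)%E.

Definition dot2 (x xi : R * R) : R := x.1 * xi.1 + x.2 * xi.2.

Definition cexpi (t : R) : R[i] := cos t +i* sin t.

Definition fourier (f : R * R -> R[i]) (xi : R * R) : R[i] :=
  ((2 * pi)^-1)%:C *
  cintegral lebesgue2 (fun x : R * R => f x * cexpi (- dot2 x xi)).

Definition polar (r omega : R) : R * R := (r * cos omega, r * sin omega).

Definition supp2 (g : R * R -> R[i]) : set (R * R) :=
  closure [set xi | g xi != 0].

(* Arc-length parametrization of the line
   { x | x_1 cos theta + x_2 sin theta = s }. *)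
Definition line_pt (theta s t : R) : R * R :=
  (s * cos theta - t * sin theta, s * sin theta + t * cos theta).

Definition radon (f : R * R -> R[i]) (theta s : R) : R[i] :=
  cintegral (@lebesgue_measure R) (fun t : R => f (line_pt theta s t)).

(* [radon] is a total function; this is the condition under which its value at
   (theta, s) is a genuine (absolutely convergent) line integral. *)
Definition radon_defined (f : R * R -> R[i]) (theta s : R) : Prop :=
  cintegrable (@lebesgue_measure R) (fun t : R => f (line_pt theta s t)).

Definition limited_radon_eq0 (Phi : R) (f : R * R -> R[i]) : Prop :=
  forall theta s : R, theta \in `[- Phi, Phi] ->
    radon_defined f theta s /\ radon f theta s = 0.

Definition smooth (f : R -> R) : Prop :=
  forall (n : nat) (x : R), derivable (derive1n n f) x 1.

Definition supp1 (f : R -> R) : set R := closure [set x | f x != 0].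

Definition radial_window (W : R -> R) : Prop :=
  [/\ smooth W,
      supp1 W `<=` `]2^-1, 2[ &
      forall r, r \in `]3 / 4, 3 / 2[ ->
        (\esum_(j in [set: int]) (W (2 ^ j * r) ^+ 2)%:E)%E = 1%E].

Definition angular_window (V : R -> R) : Prop :=
  [/\ smooth V,
      supp1 V `<=` `]-1, 1[ &
      forall omega, omega \in `]- 2^-1, 2^-1[ ->
        (\esum_(l in [set: int]) (V (omega - l%:~R) ^+ 2)%:E)%E = 1%E].

Definition lowpass_window (W W0 : R -> R) : Prop :=
  forall r, 0 <= r ->
    ((W0 r ^+ 2)%:E = 1 - \sum_(0 <= j <oo) (W (2 ^- j * r) ^+ 2)%:E)%E.

(* [f] is the function on the plane whose Fourier transform is [g], given in
   polar coordinates: integrability makes [fourier f] meaningful and continuity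
   selects the pointwise representative, so at most one [f] qualifies. *)
Definition defined_by_fourier (f : R * R -> R[i]) (g : R -> R -> R) : Prop :=
  [/\ continuous (fun x => complex.Re (f x)),
      continuous (fun x => complex.Im (f x)),
      cintegrable lebesgue2 f &
      forall r omega, 0 <= r -> omega \in `[- pi, pi[ ->
        fourier f (polar r omega) = (g r omega)%:C].

(* uphalf j is the ceiling of j / 2. *)
Definition nb_angles (j : nat) : nat := 2 ^ (uphalf j).+1.

Definition curvelet_profile (W V : R -> R) (j : nat) (r omega : R) : R :=
  2 `^ (- (3 * j%:R / 4)) * W (2 ^- j * r) *
  V ((nb_angles j)%:R / pi * omega).

Definition is_generating_curvelet (W V : R -> R) (j : nat)
    (psi : R * R -> R[i]) : Prop :=
  defined_by_fourier psi (curvelet_profile W V j).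

Definition is_lowpass_function (W0 : R -> R) (psi : R * R -> R[i]) : Prop :=
  defined_by_fourier psi (fun r _ => W0 r).

(* The matrix [cos eta, sin eta; - sin eta, cos eta] applied to x; its inverse
   is [rot2 (- eta)]. *)
Definition rot2 (eta : R) (x : R * R) : R * R :=
  (cos eta * x.1 + sin eta * x.2, - sin eta * x.1 + cos eta * x.2).

Definition curvelet_angle (j : nat) (l : int) : R :=
  l%:~R * pi / (nb_angles j)%:R.

Definition curvelet_center (j : nat) (l : int) (k : int * int) : R * R :=
  rot2 (- curvelet_angle j l)
    (k.1%:~R / 2 ^+ j, k.2%:~R / 2 `^ (j%:R / 2)).

Definition curvelet_index : set (int * int * (int * int)) :=
  [set i | match i.1.1 with
           | Posz j => - (nb_angles j)%:Z <= i.1.2 < (nb_angles j)%:Z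
           | Negz m => m = 0%N /\ i.1.2 = 0
           end].

(* Only the scale -1 (that is, [Negz 0]) is meaningful among the negative
   ones. *)
Definition curvelet (psi_low : R * R -> R[i]) (psi_gen : nat -> R * R -> R[i])
    (i : int * int * (int * int)) (x : R * R) : R[i] :=
  let: (jj, l, k) := i in
  match jj with
  | Posz j => psi_gen j (rot2 (curvelet_angle j l)
                           (x - curvelet_center j l k))
  | Negz _ => psi_low (x - (k.1%:~R, k.2%:~R))
  end.

Definition wedge (Phi : R) : set (R * R) :=
  [set xi | exists r omega : R, `|omega| <= Phi /\ xi = polar r omega].

Definition invisible_index (psi_low : R * R -> R[i])
    (psi_gen : nat -> R * R -> R[i]) (Phi : R) :
    set (int * int * (int * int)) :=
  [set i | curvelet_index i /\
     supp2 (fourier (curvelet psi_low psi_gen i)) `&` wedge Phi = set0].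

End Curvelets.

(* Main.v *)
From HB Require Import structures.
Require Import Defs.
From mathcomp Require Import all_boot all_order all_algebra.
From mathcomp Require Import complex.
From mathcomp Require Import all_classical all_reals all_analysis.
From mathcomp Require Import measurable_realfun ring lra.

Set Implicit Arguments.
Unset Strict Implicit.
Unset Printing Implicit Defensive.

Import Order.TTheory GRing.Theory Num.Theory.
Import numFieldNormedType.Exports.

Local Open Scope classical_set_scope.
Local Open Scope ring_scope.
Local Open Scope complex_scope.

(** By the Fourier slice theorem, the Radon transform of f in the direction
    theta is the function of s whose one-dimensional Fourier transform is the
    restriction of the transform of f to the line of direction theta.  For an
    invisible curvelet this restriction is zero as soon as |theta| <= Phi, so
    that the line integrals vanish for almost every s.  The theorem asserts
    more: they converge absolutely, and vanish, for every s, although all that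
    is known of a curvelet is that it is continuous and integrable on the
    plane.  The gap is closed by band-limitation: the transform of a curvelet
    vanishes outside a disc, of radius A say.

    After a rotation the lines are the vertical ones; let u be the real or the
    imaginary part of the rotated curvelet.  Convolve u with K_e (x) K_e, where
    K_e is an approximate identity on the line with an integrable Fourier
    transform; the squared Poisson kernel [kern] is one.  The result
    [smoothing] tends to u at every point ([smoothing_cvg]).  As u has no
    frequency (x, y) with |x| > A, the kernel in the first variable can be
    replaced by its part of frequencies at most A ([smoothing_band]), which is
    bounded and Lipschitz uniformly in e.  Tonelli's theorem and Fatou's lemma
    then bound the L1 norms of the sections u(s, -) and of their differences
    ([sections_L1_bound]): the line integral g(s) of u converges absolutely,
    and g is Lipschitz.  As u has no frequency (x, 0), the integral of g
    against each translate of K_e is zero, and e -> 0 gives g = 0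
    ([line_integral_eq0]).

    Frequencies are only ever used through Fubini's theorem: a kernel which is
    a superposition of cosines has integral zero against u if each of these
    cosines has ([superposition_eq0]).

    A low-pass element is never invisible: at the frequency 0, which lies in
    the wedge, its transform is W0 0, whose square is 1 ([lowpass_visible]).
    Hence the inclusion of index sets is strict, and the elements that remain
    are rotated and translated generating curvelets, of frequencies at most
    2 ^+ j.+1. *)

(** * The squared Poisson kernel *)

Section Kernels.
Variable R : realType.
Implicit Types (e a s x y : R).
Notation mu := (@lebesgue_measure R).

Lemma is_derive_continuous (F f : R -> R) x :
  is_derive x 1 F (f x) -> F z @[z --> x] --> F x.
Proof. by case=> dF _; apply: differentiable_continuous; apply/derivable1_diffP. Qed.

Lemma ge0_integral_half (f F : R -> R) (l : R) :
  (forall x, is_derive x 1 F (f x)) -> (forall x, 0 <= x -> 0 <= f x) ->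
  continuous f -> F x @[x --> +oo] --> l ->
  (\int[mu]_(x in `[0%R, +oo[) (f x)%:E = (l - F 0)%:E)%E.
Proof.
move=> dF f0 cf Fl.
rewrite (@ge0_continuous_FTC2y _ f F 0 l)//.
- exact: continuous_subspaceT.
- exact/cvg_at_right_filter/is_derive_continuous.
- by move=> x _; rewrite derive1E; exact: derive_val.
Qed.

Lemma ge0_even_integralT (f F : R -> R) (l : R) :
  (forall x, is_derive x 1 F (f x)) -> (forall x, 0 <= f x) ->
  continuous f -> (forall x, f (- x) = f x) -> F x @[x --> +oo] --> l ->
  (\int[mu]_x (f x)%:E = (2 * (l - F 0))%:E)%E.
Proof.
move=> dF f0 cf evf Fl.
rewrite ge0_symfun_integralT//; last by move=> x /=; rewrite evf.
by rewrite -set_itvcy (ge0_integral_half (l := l) dF) // EFinM.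
Qed.

Definition poisson e x : R := e / (pi * (e ^+ 2 + x ^+ 2)).
(** The squared Poisson kernel, of mass one: kern e is 2 pi e times the square
    of poisson e.  Squaring makes the decay quartic, so that a product of two
    such kernels tends to 0 uniformly away from the origin of the plane when e
    does; a product of two Poisson kernels is only bounded there. *)
Definition kern e x : R := 2 * e ^+ 3 / (pi * (e ^+ 2 + x ^+ 2) ^+ 2).
(** The Fourier transform of kern e, normalized so that kern e is its plain
    cosine integral: see kernhat_cos_integral. *)
Definition kernhat e x : R := (1 + e * `|x|) * expR (- (e * `|x|)) / (2 * pi).

Lemma sqrD_gt0 e x : 0 < e -> 0 < e ^+ 2 + x ^+ 2.
Proof. by move=> e0; rewrite ltr_wpDr ?sqr_ge0 ?exprn_gt0. Qed.

Lemma cvg_over_sqr e : 0 < e -> x / (e ^+ 2 + x ^+ 2) @[x --> +oo] --> (0 : R).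
Proof.
move=> e0; apply/cvgrPdist_le => d d0; near=> x.
have x0 : 0 < x by near: x; exact: nbhs_pinfty_gt.
rewrite sub0r normrN ger0_norm; last by rewrite divr_ge0 ?ltW// sqrD_gt0.
rewrite ler_pdivrMr ?sqrD_gt0//.
have xd : d^-1 <= x by near: x; apply: nbhs_pinfty_ge; exact: num_real.
have : 1 <= d * x by rewrite -(mulfV (lt0r_neq0 d0)) ler_pM2l.
by move=> H; nra.
Unshelve. all: end_near. Qed.

Lemma continuous_sqrD e : continuous (fun x : R => e ^+ 2 + x ^+ 2).
Proof. by move=> x; apply: cvgD; [exact: cvg_cst|exact: (@exprn_continuous R 2)]. Qed.

Lemma continuous_poisson e : 0 < e -> continuous (poisson e).
Proof.
move=> e0 x; apply: cvgM; first exact: cvg_cst.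
apply: cvgV; first by rewrite mulf_neq0 ?lt0r_neq0 ?sqrD_gt0 ?pi_gt0.
by apply: cvgM; [exact: cvg_cst | exact: continuous_sqrD].
Qed.

Lemma continuous_kern e : 0 < e -> continuous (kern e).
Proof.
move=> e0 x; apply: cvgM; first exact: cvg_cst.
apply: cvgV; first by rewrite mulf_neq0 ?expf_neq0 ?lt0r_neq0 ?sqrD_gt0 ?pi_gt0.
apply: cvgM; [exact: cvg_cst | ].
apply: (@cvg_comp _ _ _ (fun x : R => e ^+ 2 + x ^+ 2) (fun y => y ^+ 2)).
  exact: continuous_sqrD.
exact: (@exprn_continuous R 2).
Qed.

Lemma poisson_ge0 e x : 0 < e -> 0 <= poisson e x.
Proof. by move=> e0; rewrite divr_ge0 ?mulr_ge0 ?pi_ge0 ?ltW ?sqrD_gt0. Qed.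

Lemma kern_ge0 e x : 0 < e -> 0 <= kern e x.
Proof.
move=> e0; rewrite divr_ge0//; first by rewrite mulr_ge0// exprn_ge0// ltW.
by rewrite mulr_ge0 ?pi_ge0// sqr_ge0.
Qed.

Lemma cvgy_atan_div e : 0 < e -> atan (e^-1 * x) @[x --> +oo] --> pi / 2.
Proof.
move=> e0; apply: cvg_comp (@cvgy_atan R).
by apply: gt0_cvgMry; [rewrite invr_gt0|exact: cvg_id].
Qed.

Lemma poisson_integral e : 0 < e -> (\int[mu]_x (poisson e x)%:E = 1)%E.
Proof.
move=> e0; have e0' := lt0r_neq0 e0; have pi0 := lt0r_neq0 (pi_gt0 R).
have dF x : is_derive x 1 (fun x => pi^-1 * atan (e^-1 * x)) (poisson e x).
  apply: is_derive_eq.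
  have := sqrD_gt0 x e0 => /lt0r_neq0 H.
  rewrite /poisson /GRing.scale /= mulr1.
  by move: (@pi R) pi0 => p pi0; field; rewrite H pi0 e0'.
rewrite (ge0_even_integralT (l := 2^-1) dF).
- by rewrite mulr0 atan0 mulr0 subr0 mulfV.
- by move=> x; exact: poisson_ge0.
- exact: continuous_poisson.
- by move=> x; rewrite /poisson sqrrN.
- rewrite [X in _ --> X](_ : _ = pi^-1 * (pi / 2)); last by rewrite mulKf.
  by apply: cvgM; [exact: cvg_cst|exact: cvgy_atan_div].
Qed.

Lemma kern_integral e : 0 < e -> (\int[mu]_x (kern e x)%:E = 1)%E.
Proof.
move=> e0; have e0' := lt0r_neq0 e0; have pi0 := lt0r_neq0 (pi_gt0 R).
pose d x := (e ^+ 2 + x ^+ 2)^-1.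
have dF x : is_derive x 1
    (fun x => pi^-1 * (e * (x * d x) + atan (e^-1 * x))) (kern e x).
  have := sqrD_gt0 x e0 => /lt0r_neq0 H.
  have dV : is_derive x 1 d (- (2 * x) / (e ^+ 2 + x ^+ 2) ^+ 2).
    apply: DeriveDef; first exact: derivableV.
    by rewrite deriveV// derive_val /GRing.scale/=; field.
  apply: is_derive_eq.
  rewrite /d /kern /GRing.scale /= mulr1.
  by move: (@pi R) pi0 => p pi0; field; rewrite H pi0 e0'.
rewrite (ge0_even_integralT (l := 2^-1) dF).
- by rewrite !(mulr0,mul0r) atan0 addr0 mulr0 subr0 mulfV.
- by move=> x; exact: kern_ge0.
- exact: continuous_kern.
- by move=> x; rewrite /kern sqrrN.
- rewrite [X in _ --> X](_ : _ = pi^-1 * (e * 0 + (pi / 2))); last first.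
    by rewrite mulr0 add0r mulKf.
  apply: cvgM; first exact: cvg_cst.
  apply: cvgD; last exact: cvgy_atan_div.
  by apply: cvgM; [exact: cvg_cst|exact: cvg_over_sqr].
Qed.
End Kernels.

(** * The Fourier transform of the kernel *)

Section KernelTransform.
Variable R : realType.
Implicit Types (e a s x y : R).
Notation mu := (@lebesgue_measure R).

Lemma linear_expRN_cvg0 e (C : R) (G : R -> R) : 0 < e ->
  (forall x, 1 <= x -> `|G x| <= C * x) ->
  expR (- (e * x)) * G x @[x --> +oo] --> (0 : R).
Proof.
move=> e0 GC; apply/cvgrPdist_le => d d0; near=> x.
have x1 : 1 <= x by near: x; apply: nbhs_pinfty_ge; exact: num_real.
have x0 : 0 < x by exact: lt_le_trans x1.
rewrite sub0r normrN normrM ger0_norm ?expR_ge0// expRN.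
rewrite ler_pdivrMl ?expR_gt0//.
have xC : C * (2 / (e ^+ 2)) / d <= x.
  by near: x; apply: nbhs_pinfty_ge; exact: num_real.
apply: (le_trans (GC _ x1)).
(* The exponential outgrows the linear bound through its quadratic term. *)
have ex : (e * x) ^+ 2 / 2 <= expR (e * x).
  apply: le_trans (expR_ge1Dxn 1 _); last by rewrite mulr_ge0 ?ltW.
  by rewrite -[leLHS]add0r lerD2r.
apply: (@le_trans _ _ ((e * x) ^+ 2 / 2 * d)); last by rewrite ler_pM2r.
move: xC; rewrite ler_pdivrMr// mulrA ler_pdivrMr ?exprn_gt0// => xC.
by rewrite exprMn; have := ler_wpM2r (ltW x0) xC; nra.
Unshelve. all: end_near. Qed.

Lemma kernhat_ge0 e x : 0 < e -> 0 <= kernhat e x.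
Proof. move=> e0; rewrite divr_ge0//; last by rewrite mulr_ge0 ?pi_ge0.
by rewrite mulr_ge0 ?expR_ge0// addr_ge0// mulr_ge0// ltW. Qed.

Lemma kernhat_le1 e x : 0 < e -> kernhat e x <= 1.
Proof.
move=> e0; rewrite ler_pdivrMr ?mulr_gt0 ?pi_gt0// mul1r.
apply: (@le_trans _ _ 1).
  by rewrite expRN ler_pdivrMr ?expR_gt0// mul1r expR_ge1Dx.
have := pi_ge2 R; lra.
Qed.

Lemma continuous_expRNM e : continuous (fun x : R => expR (- (e * x))).
Proof.
move=> x; apply: (@cvg_comp _ _ _ (fun x => - (e * x)) (@expR R)); last first.
  exact: continuous_expR.
by apply: cvgN; apply: cvgM; [exact: cvg_cst|exact: cvg_id].
Qed.

Lemma continuous_cosM a : continuous (fun x : R => cos (a * x)).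
Proof.
move=> x; apply: (@cvg_comp _ _ _ (fun x => a * x) (@cos R)); last first.
  exact: continuous_cos.
by apply: cvgM; [exact: cvg_cst|exact: cvg_id].
Qed.

Lemma continuous_kernhat e : continuous (kernhat e).
Proof.
move=> x; rewrite /kernhat; apply: cvgM; last exact: cvg_cst.
have cn : `|z| @[z --> x] --> `|x| by exact: norm_continuous.
apply: cvgM.
  by apply: cvgD; [exact: cvg_cst|apply: cvgM; [exact: cvg_cst|]].
apply: (@cvg_comp _ _ _ (fun x : R => `|x|) (fun x => expR (- (e * x)))).
  exact: cn.
exact: continuous_expRNM.
Qed.

(** The summand 1 keeps the integrand nonnegative, so that an antiderivative
    gives the improper integral.  The case a = 0 is the mass of kernhat;
    subtracting it from the general case leaves the cosine integral. *)
Lemma kernhat_1Dcos_integral e a : 0 < e ->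
  (\int[mu]_x (kernhat e x * (1 + cos (a * x)))%:E = (kern e 0 + kern e a)%:E)%E.
Proof.
move=> e0; have e0' := lt0r_neq0 e0; have pi0 := lt0r_neq0 (pi_gt0 R).
pose D := e ^+ 2 + a ^+ 2.
have D0 : D != 0 by apply: lt0r_neq0; exact: sqrD_gt0.
(* p, q, r and w solve the linear system expressing that F' = f. *)
pose p := - 2 * e ^+ 3 / D ^+ 2.
pose q := - e ^+ 2 / D.
pose r := a * (D + 2 * e ^+ 2) / D ^+ 2.
pose w := a * e / D.
pose G x := (p + q * x) * cos (a * x) + (r + w * x) * sin (a * x) + (- 2 / e - x).
pose F x := expR (- (e * x)) * ((2 * pi)^-1 * G x).
pose f x := (1 + e * x) * expR (- (e * x)) / (2 * pi) * (1 + cos (a * x)).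
have dF x : is_derive x 1 F (f x).
  have dE : is_derive x 1 (fun x => expR (- (e * x))) (- e * expR (- (e * x))).
    apply: is_derive_eq; rewrite /GRing.scale/=; ring.
  have dC : is_derive x 1 (fun x => cos (a * x)) (- a * sin (a * x)).
    apply: is_derive_eq; rewrite /GRing.scale/=; ring.
  have dS : is_derive x 1 (fun x => sin (a * x)) (a * cos (a * x)).
    apply: is_derive_eq; rewrite /GRing.scale/=; ring.
  apply: is_derive_eq.
  rewrite /G /f /p /q /r /w /GRing.scale/=.
  move: (expR _) (cos _) (sin _) (@pi R) pi0 D0 => E C S P P0; rewrite /D => D0.
  by field; rewrite P0 D0 e0'.
rewrite ge0_symfun_integralT//=; last first.
- by move=> x /=; rewrite /kernhat normrN mulrN cosN.
- move=> x; apply: cvgM; first exact: continuous_kernhat.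
  by apply: cvgD; [exact: cvg_cst|exact: continuous_cosM].
- by move=> x; rewrite mulr_ge0 ?kernhat_ge0// -lerBlDl sub0r cos_geN1.
rewrite -set_itvcy.
under eq_integral => x.
  rewrite inE/= in_itv/= andbT => x0.
  rewrite /kernhat ger0_norm//; over.
rewrite /= (ge0_integral_half (l := 0) dF) //.
- rewrite -EFinM; congr EFin.
  rewrite /F /G /p /kern !(mulr0, oppr0, addr0, expR0, cos0, sin0, subr0, expr0n) /= /D.
  move: (@pi R) pi0 D0 => P P0; rewrite /D => D0.
  by field; rewrite P0 D0 e0'.
- move=> x x0; rewrite /f mulr_ge0 //.
    rewrite divr_ge0//; last by rewrite mulr_ge0 ?pi_ge0.
    by rewrite mulr_ge0 ?expR_ge0// addr_ge0// mulr_ge0// ltW.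
- move=> x; apply: cvgM; last by apply: cvgD; [exact: cvg_cst|exact: continuous_cosM].
  apply: cvgM; last exact: cvg_cst.
  apply: cvgM; last exact: continuous_expRNM.
  by apply: cvgD; [exact: cvg_cst|apply: cvgM; [exact: cvg_cst|exact: cvg_id]].
- pose C := (2 * pi)^-1 * (`|p| + `|q| + (`|r| + `|w|) + (`|2 / e| + 1)).
  apply: (linear_expRN_cvg0 (C := C)) => // x x1.
  have x0 : 0 <= x by apply: le_trans x1.
  have p0 : 0 <= (2 * pi)^-1 :> R by rewrite invr_ge0 mulr_ge0 ?pi_ge0.
  rewrite normrM (ger0_norm p0) /C -mulrA ler_wpM2l//.
  have lin (u v c : R) : `|c| <= 1 -> `|(u + v * x) * c| <= (`|u| + `|v|) * x.
    move=> c1; rewrite normrM; apply: (@le_trans _ _ (`|u + v * x| * 1)).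
      by rewrite ler_wpM2l.
    rewrite mulr1; apply: (le_trans (ler_normD _ _)).
    by rewrite mulrDl lerD// ?ler_peMr// normrM (ger0_norm x0).
  rewrite /G; apply: (le_trans (ler_normD _ _)); rewrite [leRHS]mulrDl lerD//.
    apply: (le_trans (ler_normD _ _)); rewrite [leRHS]mulrDl.
    by rewrite lerD// lin ?cos_max ?sin_max.
  apply: (le_trans (ler_normB _ _)).
  rewrite (_ : -2 / e = - (2 / e)) ?mulNr// normrN [leRHS]mulrDl mul1r.
  by rewrite (ger0_norm x0) lerD// ler_peMr.
Qed.

Lemma kernhat_integral e : 0 < e -> (\int[mu]_x (kernhat e x)%:E = (kern e 0)%:E)%E.
Proof.
move=> e0; have := kernhat_1Dcos_integral 0 e0.
under eq_integral do rewrite mul0r cos0 (_ : 1 + 1 = 2)// mulrC EFinM.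
rewrite ge0_integralZl//; last first.
- by move=> x _; rewrite lee_fin kernhat_ge0.
- by apply/measurable_EFinP; apply: continuous_measurable_fun; exact: continuous_kernhat.
case: (\int[mu]_x _)%E => [r| |] /=.
- rewrite -EFinM => -[] H; congr EFin; lra.
- by rewrite gt0_muley// lte_fin.
- by rewrite gt0_muleNy// lte_fin.
Qed.

Lemma integrable_kernhat e : 0 < e -> mu.-integrable setT (EFin \o kernhat e).
Proof.
move=> e0; apply/integrableP; split.
  by apply/measurable_EFinP; apply: continuous_measurable_fun; exact: continuous_kernhat.
under eq_integral do rewrite /= ger0_norm ?kernhat_ge0//.
by rewrite kernhat_integral// ltry.
Qed.

Lemma kernhat_cos_integral e a : 0 < e ->
  Rintegral mu setT (fun x => kernhat e x * cos (a * x)) = kern e a.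
Proof.
move=> e0.
have mk : measurable_fun setT (kernhat e).
  by apply: continuous_measurable_fun; exact: continuous_kernhat.
have mc : measurable_fun setT (fun x : R => cos (a * x)).
  by apply: continuous_measurable_fun; exact: continuous_cosM.
have ik := integrable_kernhat e0.
have ikc : mu.-integrable setT (EFin \o (fun x => kernhat e x * cos (a * x))).
  apply: le_integrable ik => //.
    by apply/measurable_EFinP; exact: measurable_funM.
  by move=> x _ /=; rewrite lee_fin normrM ler_piMr// cos_max.
have := kernhat_1Dcos_integral a e0.
under eq_integral do rewrite mulrDr mulr1 EFinD.
rewrite (integralD measurableT ik ikc) /= kernhat_integral// EFinD.
move/(congr1 fine); rewrite /Rintegral.
have := integrable_fin_num measurableT ikc; rewrite /comp.
case: (\int[mu]_x _)%E => //= r _; exact: addrI.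
Qed.
End KernelTransform.

(** * Rigid motions preserve Lebesgue measure *)

Section Preserve.
Context d (T : measurableType d) (R : realType).
Implicit Types (nu : {measure set T -> \bar R}) (phi : T -> T).

Definition preserves nu phi :=
  measurable_fun setT phi /\
  forall A, measurable A -> nu (phi @^-1` A) = nu A.

Lemma preserves_comp nu phi psi :
  preserves nu phi -> preserves nu psi -> preserves nu (phi \o psi).
Proof.
move=> [mphi phiE] [mpsi psiE]; split; first exact: measurableT_comp.
move=> A mA; rewrite comp_preimage psiE ?phiE//.
by rewrite -[X in measurable X]setTI; exact: mphi.
Qed.

Lemma preserves_ge0_integral nu phi (f : T -> \bar R) : preserves nu phi ->
  measurable_fun setT f -> (forall x, 0 <= f x)%E ->
  (\int[nu]_x f (phi x) = \int[nu]_x f x)%E.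
Proof.
move=> [mphi phiE] mf f0.
rewrite -[LHS]/(\int[nu]_(x in phi @^-1` setT) (f \o phi) x)%E.
rewrite -ge0_integral_pushforward//.
by apply: eq_measure_integral => A mA _; exact: phiE.
Qed.

Lemma preserves_integrable nu phi (f : T -> R) : preserves nu phi ->
  nu.-integrable setT (EFin \o f) -> nu.-integrable setT (EFin \o (f \o phi)).
Proof.
move=> pphi /integrableP[mf foo]; apply/integrableP; split.
  by apply: (measurableT_comp mf); case: pphi.
rewrite (@preserves_ge0_integral _ _ (fun x => `|(f x)%:E|%E))//.
exact: measurableT_comp.
Qed.

Lemma preserves_integral nu phi (f : T -> R) : preserves nu phi ->
  nu.-integrable setT (EFin \o f) ->
  \int[nu]_x f (phi x) = \int[nu]_x f x.
Proof.
move=> pphi intf; rewrite /Rintegral; congr fine.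
have ifp := preserves_integrable pphi intf.
case: pphi => mphi phiE.
rewrite -[LHS]/(\int[nu]_(x in phi @^-1` setT) ((EFin \o f) \o phi) x)%E.
rewrite -integral_pushforward//; last by case/integrableP: intf.
by apply: eq_measure_integral => A mA _; exact: phiE.
Qed.
End Preserve.

Section PreserveLebesgue.
Variable R : realType.
Notation mu := (@lebesgue_measure R).
Notation RR := (measurableTypeR R).

Lemma preserves_opp : preserves mu (-%R : RR -> RR).
Proof. by split => // A mA; exact: lebesgue_measureN. Qed.

Lemma preserves_translation (c : R) : preserves mu (fun x : RR => (c + x : RR)).
Proof.
have mc : measurable_fun setT (fun x : RR => (c + x : RR)).
  apply: (@measurable_funD _ _ _ _ (cst c) idfun).
    exact: measurable_cst.
  exact: measurable_id.
split => // A mA; apply/esym.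
pose nu := [the measure _ _ of pushforward mu (fun x : RR => (c + x : RR))].
suff : mu A = nu mc A by [].
apply: (@lebesgue_measure_unique _ (nu mc)) => // _ [[a b]] _ <-.
rewrite /nu/= /pushforward.
rewrite (_ : _ @^-1` _ = `]a - c, b - c]%classic); last first.
  by apply/seteqP; split => x /=; rewrite !in_itv/= ltrBlDl lerBrDl.
rewrite !lebesgue_measure_itv/= !lte_fin ltrD2r; case: ifP => // _.
by rewrite -!EFinB; congr EFin; ring.
Qed.

Lemma preserves_reflection (c : R) : preserves mu (fun x : RR => (c - x : RR)).
Proof. exact: preserves_comp (preserves_translation c) preserves_opp. Qed.

Notation mu2 := (@lebesgue2 R).

(** By definition of the product measure, this is the translation invariance of
    the measure of each vertical section. *)
Lemma preserves_shear (h : R -> R) : measurable_fun setT h ->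
  preserves mu2 (fun x : RR * RR => ((x.1, h x.1 + x.2) : RR * RR)).
Proof.
move=> mh; set phi := fun x => _.
have mphi : measurable_fun setT phi.
  apply: measurable_fun_pair => //.
  apply: (@measurable_funD _ _ _ setT (fun x : RR * RR => h x.1) snd) => //.
  exact: measurableT_comp.
split => // A mA.
rewrite /lebesgue2/= /product_measure1; apply: eq_integral => x _ /=.
rewrite -((preserves_translation (h x)).2 (xsection A x)); last first.
  exact: measurable_xsection.
congr (mu _); apply/seteqP; split => y /=; rewrite /xsection/= !inE//.
Qed.

Lemma preserves_swap : preserves mu2 (fun x : RR * RR => ((x.2, x.1) : RR * RR)).
Proof.
have mphi : measurable_fun setT (fun x : RR * RR => ((x.2, x.1) : RR * RR)).
  exact: measurable_fun_pair.
split => // A mA.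
pose nu := [the measure _ _ of
  pushforward mu2 (fun x : RR * RR => ((x.2, x.1) : RR * RR))].
apply/esym.
suff : mu2 A = nu mphi A by [].
apply: (@product_measure_unique _ _ _ _ _ mu mu (nu mphi)) => // A1 A2 mA1 mA2.
rewrite /nu/= /pushforward (_ : _ @^-1` _ = A2 `*` A1).
  by rewrite product_measure1E// muleC.
by apply/seteqP; split => -[x y] /= [].
Qed.

Lemma preserves_vshear (h : R -> R) : measurable_fun setT h ->
  preserves mu2 (fun x : RR * RR => ((x.1 + h x.2, x.2) : RR * RR)).
Proof.
move=> mh; have := preserves_comp preserves_swap
  (preserves_comp (preserves_shear mh) preserves_swap).
by congr preserves; apply/funext => -[x y] /=; rewrite addrC.
Qed.

Lemma preserves_translation2 (c : R * R) :
  preserves mu2 (fun x : RR * RR => (x - c : RR * RR)).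
Proof.
have m1 : measurable_fun setT (cst (- c.1) : R -> R) by [].
have m2 : measurable_fun setT (cst (- c.2) : R -> R) by [].
have := preserves_comp (preserves_shear m2) (preserves_vshear m1).
by congr preserves; apply/funext => -[x y] /=; rewrite [_ + y]addrC.
Qed.

(** A rotation that is not of sine 0 is a product of three shears. *)
Lemma preserves_rotation_mx (c s : R) : c ^+ 2 + s ^+ 2 = 1 -> s != 0 ->
  preserves mu2 (fun x : RR * RR =>
    ((c * x.1 + s * x.2, - s * x.1 + c * x.2) : RR * RR)).
Proof.
(* p is the tangent of half the angle. *)
move=> cs s0; pose p := (1 - c) / s.
have mlin (q : R) : measurable_fun setT (fun x : R => q * x) by exact: mulrl_measurable.
have := preserves_comp (preserves_vshear (mlin p))
  (preserves_comp (preserves_shear (mlin (- s))) (preserves_vshear (mlin p))).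
congr preserves; apply/funext => -[x y] /=.
have ps : p * s = 1 - c by rewrite divfK.
have p1c : p * (1 + c) = s.
  apply: (mulIf s0); rewrite mulrAC ps.
  by rewrite -expr2 -[RHS](addKr (c ^+ 2)) cs; ring.
have e1 : x + p * y + p * (- s * (x + p * y) + y) =
  (1 - p * s) * x + p * (1 + (1 - p * s)) * y by ring.
have e2 : - s * (x + p * y) + y = - s * x + (1 - p * s) * y by ring.
have cE : 1 - p * s = c by rewrite ps; ring.
by rewrite e1 e2 cE p1c.
Qed.

Lemma preserves_rot2 (eta : R) : preserves mu2 (@rot2 R eta : RR * RR -> RR * RR).
Proof.
have [s0|s0] := eqVneq (sin eta) 0; last first.
  exact: preserves_rotation_mx (cos2Dsin2 eta) s0.
have cs : (0 : R) ^+ 2 + 1 ^+ 2 = 1 by rewrite expr0n expr1n add0r.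
(* The half-turn is the square of the quarter turn q. *)
have q := preserves_rotation_mx cs (oner_neq0 R).
have : cos eta = 1 \/ cos eta = -1.
  have := cos2Dsin2 eta; rewrite s0 expr0n addr0 => /eqP.
  by rewrite sqrf_eq1 => /orP[] /eqP; [left|right].
move=> [c1|c1].
  have : preserves mu2 (fun x : RR * RR => x) by split.
  congr preserves; apply/funext => -[x y].
  by rewrite /rot2 s0 c1/= !(mul1r, mul0r, oppr0, addr0, add0r).
have := preserves_comp q q; congr preserves; apply/funext => -[x y].
by rewrite /rot2 s0 c1/= !(mul1r, mul0r, oppr0, addr0, add0r, mulN1r).
Qed.
End PreserveLebesgue.

(** * Superpositions of cosines *)

Lemma integrable_mul_bounded d (T : measurableType d) (R : realType)
    (m : {measure set T -> \bar R}) (f g : T -> R) (B : R) :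
  m.-integrable setT (EFin \o f) -> measurable_fun setT g ->
  (forall x, `|g x| <= B) ->
  m.-integrable setT (EFin \o (fun x => f x * g x)).
Proof.
move=> fi mg gB.
have mf : measurable_fun setT f by apply/measurable_EFinP; case/integrableP: fi.
apply: (le_integrable measurableT) (integrableZl measurableT B (integrable_norm fi)).
  by apply/measurable_EFinP; exact: measurable_funM.
move=> x _ /=; rewrite lee_fin normrM mulrC normrM normr_id.
by rewrite ler_wpM2r// (le_trans (gB x))// ler_norm.
Qed.

Section Superposition.
Context d (T : measurableType d) (R : realType).
Variable nu : {sigma_finite_measure set T -> \bar R}.
Notation mu := (@lebesgue_measure R).

Lemma integrable_tensor (w : T -> R) (k : R -> R) :
  nu.-integrable setT (EFin \o w) -> mu.-integrable setT (EFin \o k) ->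
  (nu \x mu)%E.-integrable setT
    (EFin \o (fun p : T * measurableTypeR R => w p.1 * k p.2)).
Proof.
move=> wi ki.
have mw : measurable_fun setT w by apply/measurable_EFinP; case/integrableP: wi.
have mk : measurable_fun setT k by apply/measurable_EFinP; case/integrableP: ki.
apply/integrable12ltyP.
  by apply/measurable_EFinP; apply: measurable_funM; exact: measurableT_comp.
under eq_integral => x _.
  under eq_integral do rewrite /= normrM EFinM.
  rewrite ge0_integralZl//; last first.
    by apply/measurable_EFinP; exact: measurableT_comp.
  over.
have /integrableP[_ kfin] := ki.
rewrite ge0_integralZr//=.
- apply: lte_mul_pinfty => //; [exact: integral_ge0|].
  by rewrite ge0_fin_numE ?integral_ge0//; case/integrableP: wi.
- by apply/measurable_EFinP; exact: measurableT_comp.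
- exact: integral_ge0.
Qed.

Variables (w a : T -> R) (k : R -> R).
Hypothesis wi : nu.-integrable setT (EFin \o w).
Hypothesis ma : measurable_fun setT a.
Hypothesis ki : mu.-integrable setT (EFin \o k).

Let f (p : T * measurableTypeR R) := w p.1 * k p.2 * cos (a p.1 * p.2).

Let fi : (nu \x mu)%E.-integrable setT (EFin \o f).
Proof.
apply: (@integrable_mul_bounded _ _ _ _ _
  (fun p : T * measurableTypeR R => cos (a p.1 * p.2)) 1).
- exact: integrable_tensor.
- apply: (@measurableT_comp _ _ _ _ _ _ (@cos R) _
    (fun p : T * measurableTypeR R => a p.1 * p.2)).
    by apply: continuous_measurable_fun; exact: continuous_cos.
  apply: (@measurable_funM _ _ _ _
    (fun p : T * measurableTypeR R => a p.1) snd) => //.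
  exact: measurableT_comp.
- by move=> p; exact: cos_max.
Qed.

Let kcosi y : mu.-integrable setT (EFin \o (fun x => k x * cos (a y * x))).
Proof.
apply: (integrable_mul_bounded (B := 1)) => //.
- by apply: continuous_measurable_fun; exact: continuous_cosM.
- by move=> x; exact: cos_max.
Qed.

Let wcosi x : nu.-integrable setT (EFin \o (fun y => w y * cos (a y * x))).
Proof.
apply: (integrable_mul_bounded (B := 1)) => //.
- apply: (@measurableT_comp _ _ _ _ _ _ (@cos R) _ (fun y => a y * x)).
    by apply: continuous_measurable_fun; exact: continuous_cos.
  exact: measurable_funM.
- by move=> y; exact: cos_max.
Qed.

Let FE : fubini_F mu (EFin \o f) =
  EFin \o (fun y => w y * \int[mu]_x (k x * cos (a y * x))).
Proof.
apply/funext => y; rewrite /fubini_F/= /f/=.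
under eq_integral do rewrite -mulrA EFinM.
rewrite integralZl//; last exact: kcosi.
by rewrite EFinM /Rintegral fineK//; exact: (integrable_fin_num _ (kcosi y)).
Qed.

Let GE : fubini_G nu (EFin \o f) =
  EFin \o (fun x => k x * \int[nu]_y (w y * cos (a y * x))).
Proof.
apply/funext => x; rewrite /fubini_G/= /f/=.
under eq_integral do rewrite mulrAC mulrC EFinM.
rewrite integralZl//; last exact: wcosi.
by rewrite EFinM /Rintegral fineK//; exact: (integrable_fin_num _ (wcosi x)).
Qed.

Lemma integrable_superposition :
  nu.-integrable setT (EFin \o (fun y => w y * \int[mu]_x (k x * cos (a y * x)))).
Proof. by rewrite -FE; exact: integrable_fubini_F. Qed.

(** Fubini's theorem on the product of the space of w and the line of
    frequencies: the cosines being bounded, w (x) k dominates the integrand. *)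
Lemma superposition :
  \int[nu]_y (w y * \int[mu]_x (k x * cos (a y * x))) =
  \int[mu]_x (k x * \int[nu]_y (w y * cos (a y * x))).
Proof.
have := Fubini fi.
rewrite -[X in X = _ -> _]/(\int[nu]_y fubini_F mu (EFin \o f) y)%E.
rewrite -[X in _ = X -> _]/(\int[mu]_x fubini_G nu (EFin \o f) x)%E.
by rewrite FE GE /Rintegral => ->.
Qed.

(** The only way in which the absence of frequencies enters: the inner integral
    is kern, or its part of frequencies above A, when k is kernhat or its part
    outside [-A, A]. *)
Lemma superposition_eq0 :
  (forall x, k x != 0 -> \int[nu]_y (w y * cos (a y * x)) = 0) ->
  \int[nu]_y (w y * \int[mu]_x (k x * cos (a y * x))) = 0.
Proof.
move=> k0; rewrite superposition.
under eq_Rintegral => x _.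
  rewrite (_ : _ * _ = 0); last first.
    by have [->|/k0 ->] := eqVneq (k x) 0; rewrite ?mul0r ?mulr0.
  over.
by rewrite Rintegral_cst// mul0r.
Qed.
End Superposition.

(** * Kernel estimates and frequency truncation *)

Section Truncation.
Variable R : realType.
Implicit Types (e A a x y : R).
Notation mu := (@lebesgue_measure R).

Lemma cos_lipschitz x y : `|cos x - cos y| <= `|x - y|.
Proof.
wlog yx : x y / y <= x.
  by move=> H; case: (leP y x) => [/H//|/ltW/H]; rewrite distrC [in leRHS]distrC.
have [c _ ->] := @MVT_segment R cos (fun x => - sin x) y x yx
  (fun z _ => is_derive_cos z) (continuous_subspaceT (@continuous_cos R)).
by rewrite normrM normrN ler_piMl// sin_max.
Qed.

Lemma kern_le e x : 0 < e -> kern e x <= e^-1.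
Proof.
move=> e0; rewrite /kern ler_pdivrMr ?mulr_gt0 ?pi_gt0 ?exprn_gt0 ?sqrD_gt0//.
rewrite ler_pdivlMl//.
have e4 : (e ^+ 2) ^+ 2 <= (e ^+ 2 + x ^+ 2) ^+ 2.
  by apply: lerXn2r; rewrite ?nnegrE ?lerDl ?sqr_ge0 ?(ltW (sqrD_gt0 x e0)).
rewrite (_ : e * _ = 2 * (e ^+ 2) ^+ 2); last by ring.
by apply: ler_pM => //; [rewrite exprn_ge0// sqr_ge0|exact: pi_ge2].
Qed.

Lemma kernN e x : kern e (- x) = kern e x.
Proof. by rewrite /kern sqrrN. Qed.

(** Integrated, this bounds the first absolute moment of kern e by e. *)
Lemma kern_moment e x : 0 < e -> kern e x * `|x| <= e * poisson e x.
Proof.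
move=> e0; have D0 := sqrD_gt0 x e0.
have -> : kern e x * `|x| = e * poisson e x * (2 * e * `|x| / (e ^+ 2 + x ^+ 2)).
  rewrite /kern /poisson; move: (lt0r_neq0 (pi_gt0 R)) (lt0r_neq0 D0).
  by move: (@pi R) => p p0 H; field; rewrite p0 H.
apply: ler_piMr; first by apply: mulr_ge0; [exact: ltW|exact: poisson_ge0].
rewrite ler_pdivrMr// mul1r -(real_normK (num_real x)).
have := sqr_ge0 (e - `|x|); nra.
Qed.

(** A tail of kern e is of order e ^+ 2 times a kernel of mass one, which
    bounds its mass. *)
Lemma kern_le_poisson e del x : 0 < e -> 0 < del -> del <= `|x| ->
  kern e x <= poisson e x * (2 * e ^+ 2 / del ^+ 2).
Proof.
move=> e0 d0 dx; have := sqrD_gt0 x e0 => D0.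
have -> : kern e x = poisson e x * (2 * e ^+ 2 / (e ^+ 2 + x ^+ 2)).
  rewrite /kern /poisson; move: (lt0r_neq0 (pi_gt0 R)) (lt0r_neq0 D0).
  by move: (@pi R) => p p0 H; field; rewrite p0 H.
rewrite ler_wpM2l ?poisson_ge0// ler_wpM2l//; first by rewrite mulr_ge0 ?sqr_ge0.
rewrite lef_pV2 ?posrE ?exprn_gt0//.
rewrite (@le_trans _ _ (x ^+ 2)) ?lerDr ?sqr_ge0//.
by rewrite -(real_normK (num_real x)) lerXn2r ?nnegrE ?(ltW d0).
Qed.

Lemma kern_le_far e del x : 0 < e -> 0 < del -> del <= `|x| ->
  kern e x <= e ^+ 3 / del ^+ 4.
Proof.
move=> e0 d0 dx; have := sqrD_gt0 x e0 => D0.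
rewrite /kern ler_pdivrMr ?mulr_gt0 ?pi_gt0 ?exprn_gt0//.
rewrite mulrAC ler_pdivlMr ?exprn_gt0// mulrAC [leRHS]mulrC.
rewrite ler_wpM2r ?exprn_ge0 ?(ltW e0)//.
apply: ler_pM => //; [exact: exprn_ge0 (ltW d0)|exact: pi_ge2|].
rewrite (_ : del ^+ 4 = (del ^+ 2) ^+ 2); last by rewrite -exprM.
rewrite lerXn2r ?nnegrE ?sqr_ge0 ?(ltW D0)//.
rewrite (@le_trans _ _ (x ^+ 2)) ?lerDr ?sqr_ge0//.
by rewrite -(real_normK (num_real x)) lerXn2r ?nnegrE ?(ltW d0).
Qed.

Lemma measurable_kern e : 0 < e -> measurable_fun setT (kern e).
Proof. by move=> e0; apply: continuous_measurable_fun; exact: continuous_kern. Qed.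

Lemma measurable_poisson e : 0 < e -> measurable_fun setT (poisson e).
Proof. by move=> e0; apply: continuous_measurable_fun; exact: continuous_poisson. Qed.

Lemma kern_shift_integral e y : 0 < e -> (\int[mu]_x (kern e (y - x))%:E = 1)%E.
Proof.
move=> e0; rewrite (preserves_ge0_integral
  (f := fun x : measurableTypeR R => (kern e x)%:E) (preserves_reflection y)).
- exact: kern_integral.
- by apply/measurable_EFinP; exact: measurable_kern.
- by move=> x; rewrite lee_fin kern_ge0.
Qed.

Lemma poisson_shift_integral e y : 0 < e -> (\int[mu]_x (poisson e (y - x))%:E = 1)%E.
Proof.
move=> e0; rewrite (preserves_ge0_integral
  (f := fun x : measurableTypeR R => (poisson e x)%:E) (preserves_reflection y)).
- exact: poisson_integral.
- by apply/measurable_EFinP; exact: measurable_poisson.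
- by move=> x; rewrite lee_fin poisson_ge0.
Qed.

Definition kernhat_high e A x : R := kernhat e x * \1_(~` `[- A, A]) x.
Definition kernhat_low e A x : R := kernhat e x * \1_(`[- A, A]) x.
Definition kern_low e A a : R := \int[mu]_x (kernhat_low e A x * cos (a * x)).
Definition kern_high e A a : R := \int[mu]_x (kernhat_high e A x * cos (a * x)).

Lemma integrable_kernhat_low e A : 0 < e ->
  mu.-integrable setT (EFin \o kernhat_low e A).
Proof.
move=> e0; apply: (integrable_mul_bounded (B := 1)); first exact: integrable_kernhat.
  by apply: measurable_indic.
by move=> x; rewrite indicE; case: (_ \in _); rewrite ?normr1 ?normr0.
Qed.

Lemma integrable_kernhat_high e A : 0 < e ->
  mu.-integrable setT (EFin \o kernhat_high e A).
Proof.
move=> e0; apply: (integrable_mul_bounded (B := 1)); first exact: integrable_kernhat.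
  by apply: measurable_indic; exact: measurableC.
by move=> x; rewrite indicE; case: (_ \in _); rewrite ?normr1 ?normr0.
Qed.

Lemma kernhat_high_neq0 e A x : kernhat_high e A x != 0 -> A < `|x|.
Proof.
rewrite /kernhat_high indicE in_setC; case: (boolP (x \in `[- A, A]%classic)) => /=.
  by rewrite mulr0 eqxx.
by rewrite notin_setE/= in_itv/= -ler_norml => /negP; rewrite -ltNge.
Qed.

Lemma kern_split e A a : 0 < e -> kern e a = kern_low e A a + kern_high e A a.
Proof.
move=> e0; rewrite -kernhat_cos_integral// /kern_low /kern_high -RintegralD//.
- apply: eq_Rintegral => x _; rewrite -mulrDl -mulrDr !indicE in_setC.
  by case: (_ \in _); rewrite ?addr0 ?add0r mulr1.
- apply: (integrable_mul_bounded (B := 1)); first exact: integrable_kernhat_low.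
    by apply: continuous_measurable_fun; exact: continuous_cosM.
  by move=> x; exact: cos_max.
- apply: (integrable_mul_bounded (B := 1)); first exact: integrable_kernhat_high.
    by apply: continuous_measurable_fun; exact: continuous_cosM.
  by move=> x; exact: cos_max.
Qed.

Lemma kernhat_low_integral_le e A (g : R -> R) (B : R) : 0 < e -> 0 <= A ->
  measurable_fun setT g -> (forall x, `|x| <= A -> `|g x| <= B) ->
  mu.-integrable setT (EFin \o (fun x => kernhat_low e A x * g x)) ->
  `|\int[mu]_x (kernhat_low e A x * g x)| <= B * (2 * A).
Proof.
move=> e0 A0 mg gB ig.
apply: (le_trans (le_normr_Rintegral _ ig)) => //.
have i1 : mu.-integrable setT (EFin \o (\1_(`[- A, A]) : R -> R)).
  exact: integrable_indic_itv.
have E : \int[mu]_x (B * \1_(`[- A, A]) x) = B * (2 * A).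
  rewrite RintegralZl//; congr (_ * _).
  rewrite /Rintegral integral_indic// setIT.
  transitivity (fine (if (- A < A)%R then (A - - A)%R%:E else 0%:E)).
    by have := @lebesgue_measure_itv R `[- A, A]; rewrite /= lte_fin EFinB => <-.
  by case: ltP => /=; lra.
rewrite -E; apply: le_Rintegral => //.
- exact: integrable_norm.
- exact: (integrableZl measurableT B i1).
- move=> x _; rewrite /kernhat_low indicE.
  case: (boolP (x \in `[- A, A]%classic)) => /=.
    rewrite inE/= in_itv/= -ler_norml => xA.
    rewrite !mulr1 normrM ger0_norm ?kernhat_ge0//.
    apply: (@le_trans _ _ (1 * `|g x|)); first by rewrite ler_wpM2r// kernhat_le1.
    by rewrite mul1r gB.
  by move=> _; rewrite !(mulr0, mul0r) normr0.
Qed.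

(** This bound and the next are uniform in e because kernhat <= 1 is: they
    survive the limit e -> 0. *)
Lemma kern_low_le e A a : 0 < e -> 0 <= A -> `|kern_low e A a| <= 2 * A.
Proof.
move=> e0 A0; rewrite -[leRHS]mul1r; apply: kernhat_low_integral_le => //.
- by apply: continuous_measurable_fun; exact: continuous_cosM.
- by move=> x _; exact: cos_max.
- apply: (integrable_mul_bounded (B := 1)); first exact: integrable_kernhat_low.
    by apply: continuous_measurable_fun; exact: continuous_cosM.
  by move=> x; exact: cos_max.
Qed.

Lemma kern_low_lipschitz e A a b : 0 < e -> 0 <= A ->
  `|kern_low e A a - kern_low e A b| <= A * `|a - b| * (2 * A).
Proof.
move=> e0 A0.
have mc c : measurable_fun setT (fun x : R => cos (c * x)).
  by apply: continuous_measurable_fun; exact: continuous_cosM.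
have ic c : mu.-integrable setT (EFin \o (fun x => kernhat_low e A x * cos (c * x))).
  apply: (integrable_mul_bounded (B := 1)); [exact: integrable_kernhat_low|exact: mc|].
  by move=> x; exact: cos_max.
rewrite /kern_low -RintegralB//.
under eq_Rintegral do rewrite -mulrBr.
apply: kernhat_low_integral_le => //.
- exact: measurable_funB.
- move=> x xA; apply: (le_trans (cos_lipschitz _ _)).
  by rewrite -mulrBl normrM mulrC ler_wpM2r.
- have := integrableB measurableT (ic a) (ic b).
  by apply: eq_integrable => // x _ /=; rewrite mulrBr EFinB.
Qed.
End Truncation.

(** * Pointwise convergence of the smoothing *)

Section Approx.
Variable R : realType.
Implicit Types (e A a x s t : R).
Notation mu := (@lebesgue_measure R).
Notation RR := (measurableTypeR R).
Notation mu2 := (mu \x mu)%E.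

Lemma integrable_kern e s : 0 < e ->
  mu.-integrable setT (EFin \o (fun x => kern e (s - x))).
Proof.
move=> e0; apply/integrableP; split.
  apply/measurable_EFinP; apply: (measurableT_comp (measurable_kern e0)).
  exact: (preserves_reflection s).1.
under eq_integral do rewrite /= ger0_norm ?kern_ge0//.
by rewrite kern_shift_integral// ltry.
Qed.

Lemma integrable_poisson e s : 0 < e ->
  mu.-integrable setT (EFin \o (fun x => poisson e (s - x))).
Proof.
move=> e0; apply/integrableP; split.
  apply/measurable_EFinP; apply: (measurableT_comp (measurable_poisson e0)).
  exact: (preserves_reflection s).1.
under eq_integral do rewrite /= ger0_norm ?poisson_ge0//.
by rewrite poisson_shift_integral// ltry.
Qed.

Lemma measurable_kern1 e s : 0 < e ->
  measurable_fun setT (fun y : RR * RR => kern e (s - y.1)).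
Proof.
move=> e0; apply: (measurableT_comp (measurable_kern e0)).
exact: measurableT_comp (preserves_reflection s).1 measurable_fst.
Qed.

Lemma measurable_kern2 e t : 0 < e ->
  measurable_fun setT (fun y : RR * RR => kern e (t - y.2)).
Proof.
move=> e0; apply: (measurableT_comp (measurable_kern e0)).
exact: measurableT_comp (preserves_reflection t).1 measurable_snd.
Qed.

Lemma Rintegral_tensor (f g : R -> R) :
  mu.-integrable setT (EFin \o f) -> mu.-integrable setT (EFin \o g) ->
  (forall x, 0 <= f x) -> (forall x, 0 <= g x) ->
  \int[mu2]_y (f y.1 * g y.2) = (\int[mu]_x f x) * (\int[mu]_x g x).
Proof.
move=> fi gi f0 g0.
have mf : measurable_fun setT f by apply/measurable_EFinP; case/integrableP: fi.
have mg : measurable_fun setT g by apply/measurable_EFinP; case/integrableP: gi.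
rewrite /Rintegral fubini_tonelli1/=; last 2 first.
- apply/measurable_EFinP; apply: measurable_funM; first exact: (measurableT_comp mf).
  exact: (measurableT_comp mg).
- by move=> y; rewrite lee_fin mulr_ge0.
rewrite /fubini_F/=.
under eq_integral => x _.
  under eq_integral do rewrite EFinM.
  rewrite ge0_integralZl//; last 3 first.
  - by apply/measurable_EFinP.
  - by move=> y _; rewrite lee_fin.
  - by rewrite lee_fin.
  over.
rewrite ge0_integralZr//=; last 3 first.
- by apply/measurable_EFinP.
- by move=> x _; rewrite lee_fin.
- by apply: integral_ge0 => y _; rewrite lee_fin.
by rewrite fineM//; [exact: (integrable_fin_num _ fi)|exact: (integrable_fin_num _ gi)].
Qed.

Lemma Rintegral_kern e s : 0 < e -> \int[mu]_x kern e (s - x) = 1.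
Proof. by move=> e0; rewrite /Rintegral kern_shift_integral. Qed.

Lemma Rintegral_poisson e s : 0 < e -> \int[mu]_x poisson e (s - x) = 1.
Proof. by move=> e0; rewrite /Rintegral poisson_shift_integral. Qed.

Variable u : R * R -> R.
Hypothesis ui : mu2.-integrable setT (EFin \o (u : RR * RR -> R)).

Definition l1norm := \int[mu2]_y `|u y|.

Definition smoothing e s t :=
  \int[mu2]_y (u y * (kern e (s - y.1) * kern e (t - y.2))).

Lemma integrable_smoothing e s t : 0 < e ->
  mu2.-integrable setT (EFin \o (fun y : RR * RR =>
    u y * (kern e (s - y.1) * kern e (t - y.2)))).
Proof.
move=> e0; apply: (integrable_mul_bounded (B := e^-1 * e^-1)) => //.
- by apply: measurable_funM; [exact: measurable_kern1|exact: measurable_kern2].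
- move=> y; rewrite ger0_norm; last by apply: mulr_ge0; exact: kern_ge0.
  by apply: ler_pM; rewrite ?kern_ge0 ?kern_le.
Qed.

(** Near the centre (a and b small) the continuity of the function whose values
    are v and v0 decides.  Elsewhere v is not bounded, only integrable, so that
    the product of the kernels has to be uniformly small; for v0, a constant,
    the product has to have a small mass. *)
Lemma smoothing_pointwise e (del eta a b v v0 : R) : 0 < e -> 0 < del -> 0 <= eta ->
  (`|a| < del -> `|b| < del -> `|v - v0| <= eta) ->
  `|v - v0| * (kern e a * kern e b) <=
    eta * (kern e a * kern e b) + (e ^+ 2 / del ^+ 4) * `|v| +
    `|v0| * (2 * e ^+ 2 / del ^+ 2) *
      (poisson e a * kern e b + kern e a * poisson e b).
Proof.
move=> e0 d0 eta0 H.
have ka := kern_ge0 a e0; have kb := kern_ge0 b e0.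
have pa := poisson_ge0 a e0; have pb := poisson_ge0 b e0.
have c1 : 0 <= e ^+ 2 / del ^+ 4.
  by rewrite divr_ge0 ?exprn_ge0 ?(ltW e0) ?(ltW d0).
have c2 : 0 <= 2 * e ^+ 2 / del ^+ 2.
  by rewrite divr_ge0 ?mulr_ge0 ?exprn_ge0 ?(ltW e0) ?(ltW d0).
have kk : 0 <= kern e a * kern e b by exact: mulr_ge0.
have pk : 0 <= poisson e a * kern e b by exact: mulr_ge0.
have kp : 0 <= kern e a * poisson e b by exact: mulr_ge0.
have pkkp := addr_ge0 pk kp.
have r2 : 0 <= e ^+ 2 / del ^+ 4 * `|v| by rewrite mulr_ge0.
have r3 : 0 <= `|v0| * (2 * e ^+ 2 / del ^+ 2) *
    (poisson e a * kern e b + kern e a * poisson e b).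
  by apply: mulr_ge0 => //; exact: mulr_ge0.
have far : del <= `|a| \/ del <= `|b| ->
    kern e a * kern e b <= e ^+ 2 / del ^+ 4 /\
    kern e a * kern e b <= (2 * e ^+ 2 / del ^+ 2) *
      (poisson e a * kern e b + kern e a * poisson e b).
  have e3 : e ^+ 3 / del ^+ 4 * e^-1 = e ^+ 2 / del ^+ 4.
    move: (lt0r_neq0 e0) (lt0r_neq0 d0) => e1 d1; field.
    by rewrite ?e1 ?d1.
  move=> [da|db]; split.
  - by rewrite -e3 ler_pM ?kern_le// kern_le_far.
  - apply: (@le_trans _ _ (2 * e ^+ 2 / del ^+ 2 * (poisson e a * kern e b))).
      by rewrite [leRHS]mulrA ler_wpM2r// mulrC; exact: kern_le_poisson.
    by rewrite ler_wpM2l// lerDl.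
  - by rewrite -e3 mulrC ler_pM ?kern_le// kern_le_far.
  - apply: (@le_trans _ _ (2 * e ^+ 2 / del ^+ 2 * (kern e a * poisson e b))).
      by rewrite [leRHS]mulrCA ler_wpM2l// mulrC; exact: kern_le_poisson.
    by rewrite ler_wpM2l// lerDr.
have [da|da] := ltP `|a| del; last first.
  have [f1 f2] := far (or_introl da).
  apply: (@le_trans _ _ ((`|v| + `|v0|) * (kern e a * kern e b))).
    by rewrite ler_wpM2r// ler_normB.
  rewrite mulrDl -addrA -[leLHS]add0r lerD//; first exact: mulr_ge0.
  rewrite lerD//.
    by rewrite mulrC ler_wpM2r.
  by rewrite -mulrA ler_wpM2l.
have [db|db] := ltP `|b| del; last first.
  have [f1 f2] := far (or_intror db).
  apply: (@le_trans _ _ ((`|v| + `|v0|) * (kern e a * kern e b))).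
    by rewrite ler_wpM2r// ler_normB.
  rewrite mulrDl -addrA -[leLHS]add0r lerD//; first exact: mulr_ge0.
  rewrite lerD//.
    by rewrite mulrC ler_wpM2r.
  by rewrite -mulrA ler_wpM2l.
by rewrite -addrA -[leLHS]addr0 lerD ?addr_ge0// ler_wpM2r// H.
Qed.

Lemma smoothing_error e s t (del eta : R) : 0 < e -> 0 < del -> 0 <= eta ->
  (forall y, `|s - y.1| < del -> `|t - y.2| < del -> `|u y - u (s, t)| <= eta) ->
  `|smoothing e s t - u (s, t)| <=
    eta + e ^+ 2 / del ^+ 4 * l1norm + `|u (s, t)| * (2 * e ^+ 2 / del ^+ 2) * 2.
Proof.
move=> e0 d0 eta0 H; set u0 := u (s, t).
have Ki := integrable_kern _ e0; have Pi := integrable_poisson _ e0.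
have K0 x := kern_ge0 x e0; have P0 x := poisson_ge0 x e0.
have KK := integrable_tensor (Ki s) (Ki t).
have PK := integrable_tensor (Pi s) (Ki t).
have KP := integrable_tensor (Ki s) (Pi t).
have KK1 : \int[mu2]_y (kern e (s - y.1) * kern e (t - y.2)) = 1.
  by rewrite (Rintegral_tensor (Ki s) (Ki t))// !Rintegral_kern// mulr1.
have PK1 : \int[mu2]_y (poisson e (s - y.1) * kern e (t - y.2)) = 1.
  rewrite (Rintegral_tensor (Pi s) (Ki t))//.
  by rewrite Rintegral_kern// Rintegral_poisson// mulr1.
have KP1 : \int[mu2]_y (kern e (s - y.1) * poisson e (t - y.2)) = 1.
  rewrite (Rintegral_tensor (Ki s) (Pi t))//.
  by rewrite Rintegral_kern// Rintegral_poisson// mulr1.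
have uKi := integrable_smoothing s t e0.
have u0Ki := integrableZl measurableT u0 KK.
have dKi : mu2.-integrable setT (EFin \o (fun y : RR * RR =>
    u y * (kern e (s - y.1) * kern e (t - y.2)) -
    u0 * (kern e (s - y.1) * kern e (t - y.2)))).
  exact: (integrableB measurableT uKi u0Ki).
have -> : smoothing e s t - u0 = \int[mu2]_y
    (u y * (kern e (s - y.1) * kern e (t - y.2)) -
     u0 * (kern e (s - y.1) * kern e (t - y.2))).
  by rewrite RintegralB// RintegralZl// KK1 mulr1.
apply: (le_trans (le_normr_Rintegral measurableT dKi)).
have i1 : mu2.-integrable setT (EFin \o (fun y : RR * RR =>
    eta * (kern e (s - y.1) * kern e (t - y.2)))).
  exact: (integrableZl measurableT eta KK).
have i2 : mu2.-integrable setT (EFin \o (fun y : RR * RR => e ^+ 2 / del ^+ 4 * `|u y|)).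
  exact: (integrableZl measurableT (e ^+ 2 / del ^+ 4) (integrable_norm ui)).
have iPK : mu2.-integrable setT (EFin \o (fun y : RR * RR =>
    poisson e (s - y.1) * kern e (t - y.2) +
    kern e (s - y.1) * poisson e (t - y.2))).
  exact: (integrableD measurableT PK KP).
have i3 : mu2.-integrable setT (EFin \o (fun y : RR * RR =>
    `|u0| * (2 * e ^+ 2 / del ^+ 2) *
    (poisson e (s - y.1) * kern e (t - y.2) +
     kern e (s - y.1) * poisson e (t - y.2)))).
  exact: (integrableZl measurableT (`|u0| * (2 * e ^+ 2 / del ^+ 2)) iPK).
have i12 : mu2.-integrable setT (EFin \o (fun y : RR * RR =>
    eta * (kern e (s - y.1) * kern e (t - y.2)) + e ^+ 2 / del ^+ 4 * `|u y|)).
  exact: (integrableD measurableT i1 i2).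
have -> : eta + e ^+ 2 / del ^+ 4 * l1norm +
    `|u0| * (2 * e ^+ 2 / del ^+ 2) * 2 =
  \int[mu2]_y (eta * (kern e (s - y.1) * kern e (t - y.2)) +
    (e ^+ 2 / del ^+ 4) * `|u y| + `|u0| * (2 * e ^+ 2 / del ^+ 2) *
    (poisson e (s - y.1) * kern e (t - y.2) +
     kern e (s - y.1) * poisson e (t - y.2))).
  rewrite (RintegralD measurableT i12 i3) (RintegralD measurableT i1 i2).
  rewrite (RintegralZl _ measurableT KK) KK1 mulr1.
  rewrite (RintegralZl _ measurableT (integrable_norm ui)).
  by rewrite (RintegralZl _ measurableT iPK) (RintegralD measurableT PK KP) PK1 KP1.
apply: le_Rintegral => //.
- exact: integrable_norm dKi.
- exact: (integrableD measurableT i12 i3).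
- move=> y _; rewrite -mulrBl normrM [X in _ * X <= _]ger0_norm; last first.
    by apply: mulr_ge0; exact: kern_ge0.
  apply: smoothing_pointwise => //; exact: H.
Qed.
End Approx.

(** * Smoothing of a band-limited function *)

(** Planar Lebesgue measure under a name that carries its sigma-finiteness, so
    that the plane can itself be a factor in Fubini's theorem. *)
Definition plane_measure (R : realType) :=
  (@lebesgue_measure R \x @lebesgue_measure R)%E.

HB.instance Definition _ (R : realType) :=
  Measure.copy (@plane_measure R) (@lebesgue_measure R \x @lebesgue_measure R)%E.

Lemma plane_sigma_finite (R : realType) : sigma_finite setT (@plane_measure R).
Proof.
have /sigma_finiteP[F [FT Fnd Fm]] := sigma_finiteT (@lebesgue_measure R).
exists (fun n => F n `*` F n).
  rewrite -setXTT FT; apply/seteqP; split => [[x y] [[i _ Fx] [j _ Fy]]|].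
    exists (maxn i j) => //; split => /=.
      by move: Fx; apply/subsetPset/Fnd; exact: leq_maxl.
    by move: Fy; apply/subsetPset/Fnd; exact: leq_maxr.
  by move=> [x y] [i _ [Fx Fy]]; split; exists i.
move=> i; have [mF Foo] := Fm i; split; first exact: measurableX.
rewrite /plane_measure product_measure1E//.
by apply: lte_mul_pinfty => //; rewrite ge0_fin_numE.
Qed.

HB.instance Definition _ (R : realType) :=
  Measure_isSigmaFinite.Build _ _ _ (@plane_measure R) (@plane_sigma_finite R).

Section Smoothing.
Variable R : realType.
Implicit Types (e a x s t : R).
Notation mu := (@lebesgue_measure R).
Notation RR := (measurableTypeR R).
Notation mu2 := (mu \x mu)%E.

Let nu2 :=
  [the {sigma_finite_measure set (RR * RR)%type -> \bar R} of @plane_measure R].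

(** With a free phase c, one cosine integral stands for both the cosine and the
    sine coefficient of u at xi; and translating u does not affect it. *)
Definition no_freq (u : R * R -> R) (xi : R * R) :=
  forall c : R, \int[mu2]_y (u y * cos (dot2 y xi + c)) = 0.

Variable u : R * R -> R.
Hypothesis ui : mu2.-integrable setT (EFin \o (u : RR * RR -> R)).

Let mf : measurable_fun setT (u : RR * RR -> R).
Proof. by apply/measurable_EFinP; case/integrableP: ui. Qed.

Lemma smoothing_cvg s t : {for (s, t), continuous u} ->
  smoothing u (n.+1%:R^-1) s t @[n --> \oo] --> u (s, t).
Proof.
move=> cu; apply/cvgrPdist_le => eta eta0.
have eta2 : 0 < eta / 2 by rewrite divr_gt0.
move/cvgrPdist_le : cu => /(_ _ eta2)/nbhs_ballP[del /= d0 Hd].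
pose C := l1norm u / del ^+ 4 + `|u (s, t)| * 2 / del ^+ 2 * 2.
have C0 : 0 <= C.
  rewrite addr_ge0// ?divr_ge0 ?mulr_ge0 ?exprn_ge0 ?(ltW d0)//.
    by apply: Rintegral_ge0.
  by rewrite invr_ge0 exprn_ge0 ?(ltW d0).
have r0 : 0 < eta / 2 / (C + 1) by rewrite divr_gt0// ltr_wpDl.
near=> n.
have en : n.+1%:R^-1 < eta / 2 / (C + 1).
  by near: n; exact: (near_infty_natSinv_lt (PosNum r0)).
move: en; set e := n.+1%:R^-1 => en.
have e0 : 0 < e by rewrite invr_gt0.
have e1 : e <= 1 by rewrite invf_le1 ?ler1n.
rewrite distrC; apply: (le_trans (smoothing_error ui e0 d0 (ltW eta2) _)).
  by move=> y y1 y2; rewrite distrC; apply: Hd; split.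
have -> : eta / 2 + e ^+ 2 / del ^+ 4 * l1norm u +
    `|u (s, t)| * (2 * e ^+ 2 / del ^+ 2) * 2 = eta / 2 + e ^+ 2 * C.
  by rewrite /C; ring.
have : e * (C + 1) <= eta / 2 by rewrite -ler_pdivlMr ?ltr_wpDl// ltW.
nra.
Unshelve. all: end_near. Qed.

(** The only frequencies of the product of the two cosines are (x, y) and
    (x, - y), up to sign. *)
Lemma no_freq_cos2 (x y s t : R) : no_freq u (x, y) -> no_freq u (x, - y) ->
  \int[mu2]_z (u z * cos ((s - z.1) * x) * cos ((t - z.2) * y)) = 0.
Proof.
move=> h1 h2.
have mi (xi : R * R) (c : R) : mu2.-integrable setT
    (EFin \o (fun z : RR * RR => u z * cos (dot2 z xi + c))).
  apply: (integrable_mul_bounded (B := 1)) => //; last by move=> z; exact: cos_max.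
  apply: (@measurableT_comp _ _ _ _ _ _ (@cos R)).
    by apply: continuous_measurable_fun; exact: continuous_cos.
  apply: measurable_funD; last by [].
  by apply: measurable_funD; apply: measurable_funM.
transitivity (\int[mu2]_z (2^-1 * (u z * cos (dot2 z (x, y) + (- (s * x + t * y))) +
    u z * cos (dot2 z (x, - y) + (- (s * x - t * y)))))).
  apply: eq_Rintegral => z _.
  rewrite (_ : cos (dot2 z (x, y) + _) =
      cos ((s - z.1) * x + (t - z.2) * y)); last first.
    by rewrite -cosN; congr cos; rewrite /dot2/=; ring.
  rewrite (_ : cos (dot2 z (x, - y) + _) =
      cos ((s - z.1) * x - (t - z.2) * y)); last first.
    by rewrite -cosN; congr cos; rewrite /dot2/=; ring.
  by rewrite cosD cosB; field.
rewrite RintegralZl//; last first.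
  exact: (integrableD measurableT (mi _ _) (mi _ _)).
by rewrite RintegralD// h1 h2 addr0 mulr0.
Qed.

Variable A : R.
Hypothesis A0 : 0 <= A.
Hypothesis band : forall x y, A < `|x| -> no_freq u (x, y).

Let msub1 (s : R) : measurable_fun setT (fun y : RR * RR => s - y.1).
Proof. by apply: measurable_funB. Qed.
Let msub2 (s : R) : measurable_fun setT (fun y : RR * RR => s - y.2).
Proof. by apply: measurable_funB. Qed.

Let iukern e t : 0 < e ->
  mu2.-integrable setT (EFin \o (fun y : RR * RR => u y * kern e (t - y.2))).
Proof.
move=> e0; apply: (integrable_mul_bounded (B := e^-1)) => //.
  exact: measurable_kern2.
by move=> y; rewrite ger0_norm ?kern_le// kern_ge0.
Qed.

Lemma integrable_smoothing_band e s t : 0 < e ->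
  mu2.-integrable setT (EFin \o (fun y : RR * RR =>
    u y * kern e (t - y.2) * kern_low e A (s - y.1))).
Proof.
move=> e0.
apply: (@integrable_superposition _ _ _ nu2 (fun y => u y * kern e (t - y.2))
  (fun y => s - y.1) (kernhat_low e A)) => //.
  exact: iukern.
exact: integrable_kernhat_low.
Qed.

(** Writing both kernels as superpositions of cosines, the contribution of
    kern_high is a superposition of integrals of u against products of cosines
    of frequencies (x, y) with A < |x|. *)
Lemma smoothing_band e s t : 0 < e ->
  smoothing u e s t = \int[mu2]_y (u y * kern e (t - y.2) * kern_low e A (s - y.1)).
Proof.
move=> e0.
transitivity (\int[mu2]_y (u y * kern e (t - y.2) * kern_low e A (s - y.1) +
    u y * kern e (t - y.2) * kern_high e A (s - y.1))).
  apply: eq_Rintegral => y _; rewrite -mulrDr -kern_split//.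
  by rewrite [kern e (s - y.1) * _]mulrC mulrA.
rewrite RintegralD//; last 2 first.
- exact: integrable_smoothing_band.
- apply: (@integrable_superposition _ _ _ nu2 (fun y => u y * kern e (t - y.2))
    (fun y => s - y.1) (kernhat_high e A)) => //.
    exact: iukern.
  exact: integrable_kernhat_high.
rewrite [X in _ + X](_ : _ = 0) ?addr0//.
apply: (@superposition_eq0 _ _ _ nu2 (fun y => u y * kern e (t - y.2))
  (fun y => s - y.1)) => //.
- exact: iukern.
- exact: integrable_kernhat_high.
move=> x /kernhat_high_neq0 Ax.
transitivity (\int[mu2]_y (u y * cos ((s - y.1) * x) *
    \int[mu]_z (kernhat e z * cos ((t - y.2) * z)))).
  by apply: eq_Rintegral => y _; rewrite kernhat_cos_integral// mulrAC.
apply: (@superposition_eq0 _ _ _ nu2 (fun y => u y * cos ((s - y.1) * x))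
  (fun y => t - y.2)) => //.
- apply: (integrable_mul_bounded (B := 1)) => //; last by move=> z; exact: cos_max.
  apply: (@measurableT_comp _ _ _ _ _ _ (@cos R)).
    by apply: continuous_measurable_fun; exact: continuous_cos.
  exact: measurable_funM.
- exact: integrable_kernhat.
by move=> y _; apply: no_freq_cos2; exact: band.
Qed.

End Smoothing.

(** * An L1 bound on parallel sections *)

Section SectionBound.
Variable R : realType.
Implicit Types (e a x s t : R).
Notation mu := (@lebesgue_measure R).
Notation RR := (measurableTypeR R).
Notation mu2 := (mu \x mu)%E.
Let nu2 :=
  [the {sigma_finite_measure set (RR * RR)%type -> \bar R} of @plane_measure R].

Variables (u : R * R -> R) (A : R).
Hypothesis ui : mu2.-integrable setT (EFin \o (u : RR * RR -> R)).
Hypothesis cu : continuous u.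
Hypothesis A0 : 0 <= A.
Hypothesis band : forall x y, A < `|x| -> no_freq u (x, y).

Let mf : measurable_fun setT (u : RR * RR -> R).
Proof. by apply/measurable_EFinP; case/integrableP: ui. Qed.

Let measurable_kern12 e : 0 < e ->
  measurable_fun setT (fun p : RR * (RR * RR) => kern e (p.1 - p.2.2)).
Proof.
move=> e0; apply: (measurableT_comp (measurable_kern e0)).
apply: measurable_funB => //.
exact: measurableT_comp measurable_snd measurable_snd.
Qed.

Let kern_int e t : 0 < e -> (\int[mu]_x (kern e (x - t))%:E = 1)%E.
Proof.
move=> e0; rewrite -(kern_shift_integral t e0); apply: eq_integral => x _.
by rewrite -[in RHS]opprB kernN.
Qed.

(** Joint integrability in the position t on a line and the point y of the
    plane; it makes the smoothing measurable in t. *)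
Lemma integrable_kern_tensor (w : R * R -> R) e : 0 < e ->
  mu2.-integrable setT (EFin \o (w : RR * RR -> R)) ->
  (mu \x nu2)%E.-integrable setT
    (EFin \o (fun p : RR * (RR * RR) => w p.2 * kern e (p.1 - p.2.2))).
Proof.
move=> e0 wi.
have mw : measurable_fun setT (w : RR * RR -> R).
  by apply/measurable_EFinP; case/integrableP: wi.
apply/integrable21ltyP.
  apply/measurable_EFinP; apply: measurable_funM; last exact: measurable_kern12.
  exact: measurableT_comp mw measurable_snd.
under eq_integral => y _.
  under eq_integral => t _.
    rewrite /= normrM EFinM (ger0_norm (kern_ge0 _ e0)); over.
  rewrite ge0_integralZl//; last 2 first.
  - apply/measurable_EFinP; apply: (measurableT_comp (measurable_kern e0)).
    exact: measurable_funB.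
  - by move=> t _; rewrite lee_fin kern_ge0.
  rewrite kern_int// mule1; over.
by have /integrableP[_] := wi.
Qed.

Lemma measurable_smoothing e s : 0 < e -> measurable_fun setT (smoothing u e s).
Proof.
move=> e0.
have wi : mu2.-integrable setT (EFin \o (fun y : RR * RR => u y * kern e (s - y.1))).
  apply: (integrable_mul_bounded (B := e^-1)) => //; first exact: measurable_kern1.
  by move=> y; rewrite ger0_norm ?kern_le// kern_ge0.
have := measurable_fubini_F (integrable_kern_tensor e0 wi).
rewrite [X in measurable_fun _ X](_ : _ = EFin \o smoothing u e s).
  by move/measurable_EFinP.
apply/funext => t; rewrite /fubini_F/= /smoothing /Rintegral fineK.
  by apply: eq_integral => y _; rewrite mulrA.
exact: (integrable_fin_num _ (integrable_smoothing ui s t e0)).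
Qed.

(** Smoothing with a kernel bounded by B in the first variable and of mass one
    in the second has sections of norm at most B times that of u; as the bound
    is uniform in e and the smoothing converges at each point of each line,
    Fatou's lemma passes it on to u.  The two coefficients serve to estimate
    both one section and the difference of two. *)
Lemma sections_L1_bound (c1 c2 s1 s2 B : R) : 0 <= B ->
  (forall e a, 0 < e ->
    `|c1 * kern_low e A (s1 - a) + c2 * kern_low e A (s2 - a)| <= B) ->
  (\int[mu]_t `|(c1 * u (s1, t) + c2 * u (s2, t))%:E| <= (B * l1norm u)%:E)%E.
Proof.
move=> B0 HB.
pose h n t := c1 * smoothing u n.+1%:R^-1 s1 t + c2 * smoothing u n.+1%:R^-1 s2 t.
have mh n : measurable_fun setT (h n).
  have e0 : 0 < n.+1%:R^-1 :> R by rewrite invr_gt0.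
  by apply: measurable_funD; apply: measurable_funM => //; exact: measurable_smoothing.
have h_cvg t :
    (`|(h n t)%:E| @[n --> \oo] --> `|(c1 * u (s1, t) + c2 * u (s2, t))%:E|)%E.
  apply: cvg_abse; apply: cvg_EFin; first exact: nearW.
  by apply: cvgD; (apply: cvgM; [exact: cvg_cst|apply: smoothing_cvg => //; exact: cu]).
have -> : (\int[mu]_t `|(c1 * u (s1, t) + c2 * u (s2, t))%:E| =
    \int[mu]_t limn_einf (fun n => `|(h n t)%:E|))%E.
  apply: eq_integral => t _; rewrite is_cvg_limn_einfE; last first.
    by apply/cvg_ex; eexists; exact: h_cvg.
  by apply/esym/cvg_lim => //; exact: h_cvg.
apply: (le_trans (fatou _ _ _ _)) => //.
  by move=> n; apply: measurableT_comp => //; apply/measurable_EFinP; exact: mh.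
rewrite limn_einf_lim; apply: lime_le; first exact: is_cvg_einfs.
apply: nearW => n; rewrite /einfs.
apply: (@le_trans _ _ (\int[mu]_t `|(h n t)%:E|)%E).
  by apply: ereal_inf_lbound; exists n => //=.
have e0 : 0 < n.+1%:R^-1 :> R by rewrite invr_gt0.
rewrite /h; set e := n.+1%:R^-1 in e0 *.
have uB : mu2.-integrable setT (EFin \o (fun y : RR * RR => B * `|u y|)).
  exact: (integrableZl measurableT B (integrable_norm ui)).
have iB t : mu2.-integrable setT
    (EFin \o (fun y : RR * RR => B * `|u y| * kern e (t - y.2))).
  apply: (integrable_mul_bounded (B := e^-1)) => //; first exact: measurable_kern2.
  by move=> y; rewrite ger0_norm ?kern_le// kern_ge0.
apply: (@le_trans _ _ (\int[mu]_t \int[nu2]_y (B * `|u y| * kern e (t - y.2))%:E)%E).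
  apply: ge0_le_integral => //.
  - apply: measurableT_comp => //; apply/measurable_EFinP; exact: mh.
  - apply: (@measurable_fun_fubini_tonelli_F _ _ _ _ _ nu2
      (fun p : RR * (RR * RR) => (B * `|u p.2| * kern e (p.1 - p.2.2))%:E)).
      by case/integrableP: (integrable_kern_tensor e0 uB).
    by move=> p; rewrite lee_fin mulr_ge0 ?kern_ge0// mulr_ge0.
  - move=> t _.
    have i1 := integrable_smoothing_band ui A s1 t e0.
    have i2 := integrable_smoothing_band ui A s2 t e0.
    have i12 : mu2.-integrable setT (EFin \o (fun y : RR * RR =>
        c1 * (u y * kern e (t - y.2) * kern_low e A (s1 - y.1)) +
        c2 * (u y * kern e (t - y.2) * kern_low e A (s2 - y.1)))).
      exact: (integrableD measurableT (integrableZl measurableT c1 i1)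
        (integrableZl measurableT c2 i2)).
    have -> : c1 * smoothing u e s1 t + c2 * smoothing u e s2 t =
      \int[mu2]_y (c1 * (u y * kern e (t - y.2) * kern_low e A (s1 - y.1)) +
        c2 * (u y * kern e (t - y.2) * kern_low e A (s2 - y.1))).
      rewrite RintegralD//; last 2 first.
      + exact: (integrableZl measurableT c1 i1).
      + exact: (integrableZl measurableT c2 i2).
      by rewrite RintegralZl// RintegralZl// !(smoothing_band ui band).
    have -> : (\int[nu2]_y (B * `|u y| * kern e (t - y.2))%:E =
        (\int[mu2]_y (B * `|u y| * kern e (t - y.2)))%:E)%E.
      by rewrite /Rintegral fineK//; exact: (integrable_fin_num _ (iB t)).
    rewrite /= lee_fin; apply: (le_trans (le_normr_Rintegral _ i12)) => //.
    apply: le_Rintegral => //; first exact: integrable_norm i12.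
    move=> y _.
    rewrite (_ : _ + _ = u y * kern e (t - y.2) *
      (c1 * kern_low e A (s1 - y.1) + c2 * kern_low e A (s2 - y.1))); last by ring.
    rewrite normrM mulrC normrM (ger0_norm (kern_ge0 _ e0)) -mulrA ler_wpM2r ?HB//.
    by rewrite mulr_ge0 ?kern_ge0.
rewrite (@fubini_tonelli _ _ _ _ _ mu nu2 (fun p : RR * (RR * RR) =>
  (B * `|u p.2| * kern e (p.1 - p.2.2))%:E)); last 2 first.
- by case/integrableP: (integrable_kern_tensor e0 uB).
- by move=> p; rewrite lee_fin mulr_ge0 ?kern_ge0// mulr_ge0.
rewrite /l1norm -RintegralZl//; last exact: integrable_norm.
rewrite /Rintegral fineK; last exact: (integrable_fin_num _ uB).
rewrite le_eqVlt; apply/orP; left; apply/eqP.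
apply: eq_integral => y _ /=.
under eq_integral do rewrite EFinM.
rewrite ge0_integralZl//; last 3 first.
- apply/measurable_EFinP; apply: (measurableT_comp (measurable_kern e0)).
  exact: measurable_funB.
- by move=> t _; rewrite lee_fin kern_ge0.
- by rewrite lee_fin mulr_ge0.
by rewrite kern_int// mule1.
Qed.
End SectionBound.

(** * Line integrals of a band-limited function *)

Section LineIntegral.
Variable R : realType.
Implicit Types (e a x s t : R).
Notation mu := (@lebesgue_measure R).
Notation RR := (measurableTypeR R).
Notation mu2 := (mu \x mu)%E.
Let nu2 :=
  [the {sigma_finite_measure set (RR * RR)%type -> \bar R} of @plane_measure R].

Variables (u : R * R -> R) (A : R).
Hypothesis ui : mu2.-integrable setT (EFin \o (u : RR * RR -> R)).
Hypothesis cu : continuous u.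
Hypothesis A0 : 0 <= A.
Hypothesis band : forall x y, A < `|x| -> no_freq u (x, y).

Let mf : measurable_fun setT (u : RR * RR -> R).
Proof. by apply/measurable_EFinP; case/integrableP: ui. Qed.

Lemma integrable_section s : mu.-integrable setT (EFin \o (fun t => u (s, t))).
Proof.
apply/integrableP; split.
  apply/measurable_EFinP; exact: (measurableT_comp mf (pair1_measurable s)).
apply: (@le_lt_trans _ _ ((2 * A) * l1norm u)%:E); last exact: ltry.
have := sections_L1_bound ui cu band (c1 := 1) (c2 := 0)
  (s1 := s) (s2 := s) (B := 2 * A).
rewrite mulr_ge0// => /(_ isT) H.
apply: le_trans (H _).
  rewrite le_eqVlt; apply/orP; left; apply/eqP; apply: eq_integral => t _ /=.
  by rewrite mul1r mul0r addr0.
by move=> e a e0; rewrite mul1r mul0r addr0; exact: kern_low_le.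
Qed.

Definition line_integral s := \int[mu]_t u (s, t).

(** Continuity in s is what turns a statement on almost every line into one on
    every line. *)
Lemma line_integral_lipschitz s1 s2 :
  `|line_integral s1 - line_integral s2| <= (A * `|s1 - s2| * (2 * A)) * l1norm u.
Proof.
have i1 := integrable_section s1; have i2 := integrable_section s2.
have i12 : mu.-integrable setT (EFin \o (fun t => u (s1, t) - u (s2, t))).
  exact: (integrableB measurableT i1 i2).
rewrite /line_integral -RintegralB//.
apply: (le_trans (le_normr_Rintegral _ i12)) => //.
have i12n := integrable_norm i12.
rewrite -lee_fin /Rintegral fineK; last exact: (integrable_fin_num _ i12n).
have := sections_L1_bound ui cu band (c1 := 1) (c2 := -1)
  (s1 := s1) (s2 := s2) (B := A * `|s1 - s2| * (2 * A)).
rewrite !mulr_ge0// => /(_ isT) H.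
apply: le_trans (H _).
  rewrite le_eqVlt; apply/orP; left; apply/eqP; apply: eq_integral => t _ /=.
  by rewrite mul1r mulN1r.
move=> e a e0; rewrite mul1r mulN1r.
apply: (le_trans (kern_low_lipschitz _ _ e0 A0)).
by rewrite (_ : s1 - a - (s2 - a) = s1 - s2); last by ring.
Qed.

Hypothesis line0 : forall x, no_freq u (x, 0).

(** The slice theorem: a function of the first coordinate only has frequencies
    of the form (x, 0). *)
Lemma plane_kern_integral e s : 0 < e -> \int[mu2]_y (u y * kern e (s - y.1)) = 0.
Proof.
move=> e0.
transitivity (\int[mu2]_y (u y * \int[mu]_z (kernhat e z * cos ((s - y.1) * z)))).
  by apply: eq_Rintegral => y _; rewrite kernhat_cos_integral.
apply: (@superposition_eq0 _ _ _ nu2 u (fun y => s - y.1)) => //.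
- exact: measurable_funB.
- exact: integrable_kernhat.
move=> x _; rewrite -[RHS](line0 x (- (s * x))).
apply: eq_Rintegral => y _; rewrite -cosN; congr (_ * cos _).
by rewrite /dot2/=; ring.
Qed.

(** The average of line_integral with weight kern e around s is 0 by
    plane_kern_integral.  It differs from the value at s by at most the
    Lipschitz constant L times the first moment of kern e, that is L * e. *)
Lemma line_integral_eq0 s : line_integral s = 0.
Proof.
pose L := A * (2 * A) * l1norm u.
have L0 : 0 <= L by rewrite !mulr_ge0//; exact: Rintegral_ge0.
suff H e : 0 < e -> `|line_integral s| <= L * e.
  apply/eqP; rewrite -normr_le0; apply/ler_addgt0Pl => e e0.
  have L1 : 0 < L + 1 by rewrite ltr_wpDl.
  rewrite addr0; apply: (le_trans (H (e / (L + 1)) _)); first exact: divr_gt0.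
  by rewrite mulrCA ler_piMr ?(ltW e0)// ler_pdivrMr// mul1r lerDl.
move=> e0.
have wi : mu2.-integrable setT
    (EFin \o (fun y : RR * RR => u y * kern e (s - y.1))).
  apply: (integrable_mul_bounded (B := e^-1)) => //; first exact: measurable_kern1.
  by move=> y; rewrite ger0_norm ?kern_le// kern_ge0.
have FE : fubini_F mu (EFin \o (fun y : RR * RR => u y * kern e (s - y.1))) =
    (EFin \o (fun x : RR => kern e (s - x) * line_integral x)).
  apply/funext => x; rewrite /fubini_F/=.
  under eq_integral => y _ do rewrite [_ * kern _ _]mulrC (EFinM (kern e (s - x))).
  rewrite integralZl//; last exact: integrable_section.
  rewrite /line_integral /Rintegral/= [RHS](EFinM (kern e (s - x))) fineK//.
  exact: (integrable_fin_num _ (integrable_section x)).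
have i1 : mu.-integrable setT
    (EFin \o (fun x : RR => kern e (s - x) * line_integral x)).
  by rewrite -FE; exact: integrable_fubini_F.
have E0 : \int[mu]_x (kern e (s - x) * line_integral x) = 0.
  rewrite -[RHS](plane_kern_integral s e0) /Rintegral -integral12_prod_meas1//.
  by rewrite FE.
have Ki := integrable_kern s e0.
have i2 : mu.-integrable setT
    (EFin \o (fun x : RR => line_integral s * kern e (s - x))).
  exact: (integrableZl measurableT (line_integral s) Ki).
have i21 : mu.-integrable setT (EFin \o (fun x : RR =>
    line_integral s * kern e (s - x) - kern e (s - x) * line_integral x)).
  exact: (integrableB measurableT i2 i1).
have -> : line_integral s =
    \int[mu]_x (line_integral s * kern e (s - x) - kern e (s - x) * line_integral x).
  by rewrite RintegralB// E0 subr0 RintegralZl// Rintegral_kern// mulr1.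
apply: (le_trans (le_normr_Rintegral _ i21)) => //.
have i3 : mu.-integrable setT (EFin \o (fun x : RR => L * e * poisson e (s - x))).
  exact: (integrableZl measurableT (L * e) (integrable_poisson s e0)).
apply: (@le_trans _ _ (\int[mu]_x (L * e * poisson e (s - x)))); last first.
  by rewrite RintegralZl ?Rintegral_poisson ?mulr1//; exact: integrable_poisson.
apply: le_Rintegral => //; first exact: integrable_norm i21.
move=> x _; rewrite mulrC -mulrBr normrM (ger0_norm (kern_ge0 _ e0)).
apply: (@le_trans _ _ (kern e (s - x) * (L * `|s - x|))).
  rewrite ler_wpM2l ?kern_ge0//; apply: (le_trans (line_integral_lipschitz _ _)).
  by rewrite le_eqVlt; apply/orP; left; apply/eqP; rewrite /L; ring.
by rewrite mulrCA -mulrA ler_wpM2l// kern_moment.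
Qed.

End LineIntegral.

(** * Rigid motions and the Fourier transform *)

Section Reduction.
Variable R : realType.
Implicit Types (x y xi eta : R * R) (r s t : R).
Notation mu := (@lebesgue_measure R).
Notation RR := (measurableTypeR R).
Notation mu2 := (mu \x mu)%E.

Lemma polar_coordinates xi : exists r omega,
  [/\ 0 <= r, omega \in `[- pi, pi[ & xi = polar r omega].
Proof.
case: xi => x y; pose r := Num.sqrt (x ^+ 2 + y ^+ 2).
have r2 : r ^+ 2 = x ^+ 2 + y ^+ 2 by rewrite sqr_sqrtr// addr_ge0 ?sqr_ge0.
have pi0 := pi_gt0 R.
have [r0|r0] := eqVneq r 0.
  exists 0, 0; rewrite lexx in_itv/= oppr_le0 ltW// pi0; split => //.
  move/esym/eqP: r2; rewrite r0 expr0n/= paddr_eq0 ?sqr_ge0// !sqrf_eq0.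
  by move=> /andP[/eqP-> /eqP->]; rewrite /polar !mul0r.
have rp : 0 < r by rewrite lt_neqAle eq_sym r0 sqrtr_ge0.
pose cc := x / r; pose ss := y / r.
have cs : cc ^+ 2 + ss ^+ 2 = 1.
  by rewrite !expr_div_n -mulrDl -r2 mulfV// expf_neq0.
have c1 : -1 <= cc <= 1.
  rewrite -ler_norml -(@ler_pXn2r _ 2)// ?nnegrE// real_normK ?num_real//.
  by rewrite expr1n -cs lerDl sqr_ge0.
have sa : sin (acos cc) = `|ss|.
  by rewrite sin_acos// -cs addrC addKr sqrtr_sqr.
have a0 := acos_ge0 c1; have api := acos_lepi c1.
have xE : x = r * cc by rewrite mulrC divfK.
have yE : y = r * ss by rewrite mulrC divfK.
have [/andP[s0 alt]|H] := boolP ((0 <= ss) && (acos cc < pi)).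
  exists r, (acos cc); split; first exact: ltW.
    by rewrite in_itv/= alt andbT (le_trans _ a0)// oppr_le0 ltW.
  by rewrite /polar acosK// sa ger0_norm// -xE -yE.
(* This branch includes acos cc = pi, sent to the end - pi of the interval. *)
exists r, (- acos cc); split; first exact: ltW.
  by rewrite in_itv/= lerN2 api/= (le_lt_trans _ pi0)// oppr_le0.
rewrite /polar cosN sinN acosK// sa -xE; congr pair; rewrite yE; congr (_ * _).
move: H; rewrite negb_and -ltNge => /orP[s0|]; first by rewrite ltr0_norm ?opprK.
rewrite -leNgt => pia; have aE : acos cc = pi by apply/eqP; rewrite eq_le api.
move: sa; rewrite aE sinpi => /esym/eqP; rewrite normr_eq0 => /eqP->.
by rewrite normr0 oppr0.
Qed.

Lemma dot2_rot2 (alpha : R) x y : dot2 x (rot2 (- alpha) y) = dot2 (rot2 alpha x) y.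
Proof. by rewrite /dot2 /rot2/= cosN sinN; ring. Qed.

Lemma rot2K (alpha : R) x : rot2 (- alpha) (rot2 alpha x) = x.
Proof.
case: x => x y; rewrite /rot2/= cosN sinN.
have cs := cos2Dsin2 alpha.
by congr pair; rewrite -[RHS]mul1r -cs; ring.
Qed.

Lemma normsq_rot2 (alpha : R) x :
  (rot2 alpha x).1 ^+ 2 + (rot2 alpha x).2 ^+ 2 = x.1 ^+ 2 + x.2 ^+ 2.
Proof.
by rewrite -[RHS]mul1r -(cos2Dsin2 alpha) /rot2/=; ring.
Qed.

Definition rigid (alpha : R) (b : R * R) (x : R * R) := rot2 alpha (x - b).

Lemma preserves_rigid alpha b : preserves mu2 (rigid alpha b : RR * RR -> RR * RR).
Proof. exact: preserves_comp (preserves_rot2 alpha) (preserves_translation2 b). Qed.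

Lemma continuous_rigid alpha b : continuous (rigid alpha b).
Proof.
move=> x; rewrite /rigid /rot2.
have c1 : (y - b).1 @[y --> x] --> (x - b).1.
  by apply: cvgB; [exact: cvg_fst|exact: cvg_cst].
have c2 : (y - b).2 @[y --> x] --> (x - b).2.
  by apply: cvgB; [exact: cvg_snd|exact: cvg_cst].
have cl (p q : R) : p * (y - b).1 + q * (y - b).2 @[y --> x] -->
    p * (x - b).1 + q * (x - b).2.
  by apply: cvgD; apply: cvgM => //; exact: cvg_cst.
exact: (cvg_pair (cl (cos alpha) (sin alpha)) (cl (- sin alpha) (cos alpha))).
Qed.

(** The rotation acts on the frequency and the translation on the phase, over
    which no_freq quantifies. *)
Lemma no_freq_rigid (u : R * R -> R) alpha b eta :
  mu2.-integrable setT (EFin \o (u : RR * RR -> R)) ->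
  no_freq u eta -> no_freq (u \o rigid alpha b) (rot2 (- alpha) eta).
Proof.
move=> ui u0 cc.
pose c' := dot2 (rot2 alpha b) eta + cc.
have ic : mu2.-integrable setT
    (EFin \o (fun x : RR * RR => u x * cos (dot2 x eta + c'))).
  apply: (integrable_mul_bounded (B := 1)) => //; last by move=> z; exact: cos_max.
  apply: (@measurableT_comp _ _ _ _ _ _ (@cos R)).
    by apply: continuous_measurable_fun; exact: continuous_cos.
  apply: measurable_funD; last by [].
  by apply: measurable_funD; apply: measurable_funM.
rewrite -(u0 c') -(preserves_integral (preserves_rigid alpha b) ic).
apply: eq_Rintegral => y _ /=; congr (_ * cos _).
by rewrite dot2_rot2 /c' /rigid /dot2 /rot2/=; ring.
Qed.

Lemma integrable_trig (g : R * R -> R) xi :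
  mu2.-integrable setT (EFin \o (g : RR * RR -> R)) ->
  mu2.-integrable setT (EFin \o (fun x : RR * RR => g x * cos (dot2 x xi))) /\
  mu2.-integrable setT (EFin \o (fun x : RR * RR => g x * sin (dot2 x xi))).
Proof.
move=> gi; have md : measurable_fun setT (fun x : RR * RR => dot2 x xi).
  by apply: measurable_funD; apply: measurable_funM.
split; apply: (integrable_mul_bounded (B := 1)) => //.
- apply: (@measurableT_comp _ _ _ _ _ _ (@cos R)) md.
  by apply: continuous_measurable_fun; exact: continuous_cos.
- by move=> x; exact: cos_max.
- apply: (@measurableT_comp _ _ _ _ _ _ (@sin R)) md.
  by apply: continuous_measurable_fun; exact: continuous_sin.
- by move=> x; exact: sin_max.
Qed.

Lemma fourierE (f : R * R -> R[i]) xi : cintegrable (@lebesgue2 R) f ->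
  fourier f xi = ((2 * pi)^-1)%:C *
    ((\int[mu2]_x (complex.Re (f x) * cos (dot2 x xi)) +
      \int[mu2]_x (complex.Im (f x) * sin (dot2 x xi))) +i*
     (\int[mu2]_x (complex.Im (f x) * cos (dot2 x xi)) -
      \int[mu2]_x (complex.Re (f x) * sin (dot2 x xi)))).
Proof.
move=> [ri ii]; have [uc us] := integrable_trig xi ri.
have [vc vs] := integrable_trig xi ii.
rewrite /fourier /cintegral -RintegralD// -RintegralB//.
congr (_ * (_ +i* _)).
  by apply: eq_Rintegral => x _; case: (f x) => p q /=; rewrite cosN sinN mulrN opprK.
by apply: eq_Rintegral => x _; case: (f x) => p q /=; rewrite cosN sinN mulrN addrC.
Qed.

(** The transform at xi alone mixes the coefficients of the real part with those
    of the imaginary part; its value at - xi gives the two further equations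
    that separate them. *)
Lemma fourier0_no_freq (f : R * R -> R[i]) xi :
  cintegrable (@lebesgue2 R) f -> fourier f xi = 0 -> fourier f (- xi) = 0 ->
  no_freq (fun x => complex.Re (f x)) xi /\
  no_freq (fun x => complex.Im (f x)) xi.
Proof.
move=> [ri ii] f1 f2.
pose u x := complex.Re (f x); pose v x := complex.Im (f x).
have [uc us] := integrable_trig xi ri.
have [vc vs] := integrable_trig xi ii.
pose C g := \int[mu2]_x (g x * cos (dot2 x xi)).
pose S g := \int[mu2]_x (g x * sin (dot2 x xi)).
have pi20 : ((2 * pi)^-1)%:C != 0 :> R[i].
  by rewrite eq_complex/= eqxx andbT invr_eq0 mulf_neq0 ?lt0r_neq0 ?pi_gt0.
have fi : cintegrable (@lebesgue2 R) f by [].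
have F1 : C u + S v = 0 /\ C v - S u = 0.
  move: f1; rewrite (fourierE _ fi) => /eqP.
  by rewrite mulf_eq0 (negbTE pi20) => /eqP[].
have CN g : \int[mu2]_x (g x * cos (dot2 x (- xi))) = C g.
  apply: eq_Rintegral => x _; rewrite -cosN; congr (_ * cos _).
  by rewrite /dot2/=; ring.
have SN g :
    mu2.-integrable setT (EFin \o (fun x : RR * RR => g x * sin (dot2 x xi))) ->
    \int[mu2]_x (g x * sin (dot2 x (- xi))) = - S g.
  move=> gi; rewrite /S -[RHS]mulN1r -RintegralZl//.
  apply: eq_Rintegral => x _; rewrite (_ : dot2 x (- xi) = - dot2 x xi).
    by rewrite sinN mulrN mulN1r.
  by rewrite /dot2/=; ring.
have F2 : C u - S v = 0 /\ C v + S u = 0.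
  move: f2; rewrite (fourierE _ fi) !CN !SN// opprK => /eqP.
  by rewrite mulf_eq0 (negbTE pi20) => /eqP[].
have [Cu Su Cv Sv] : [/\ C u = 0, S u = 0, C v = 0 & S v = 0].
  by move: F1 F2 => [? ?] [? ?]; split; lra.
have comb g cc :
    mu2.-integrable setT (EFin \o (fun x : RR * RR => g x * cos (dot2 x xi))) ->
    mu2.-integrable setT (EFin \o (fun x : RR * RR => g x * sin (dot2 x xi))) ->
    C g = 0 -> S g = 0 -> \int[mu2]_x (g x * cos (dot2 x xi + cc)) = 0.
  move=> ic is_ Cg Sg.
  transitivity (\int[mu2]_x (cos cc * (g x * cos (dot2 x xi)) -
      sin cc * (g x * sin (dot2 x xi)))).
    by apply: eq_Rintegral => x _; rewrite cosD; ring.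
  rewrite RintegralB//; last 2 first.
  - exact: (integrableZl measurableT (cos cc) ic).
  - exact: (integrableZl measurableT (sin cc) is_).
  rewrite RintegralZl// RintegralZl//.
  by rewrite -/(C g) -/(S g) Cg Sg !mulr0 subr0.
by split => cc; exact: comb.
Qed.

End Reduction.

(** * Invisible curvelets *)

Section Invisible.
Variable R : realType.
Implicit Types (xi : R * R) (r s t : R).
Notation mu := (@lebesgue_measure R).
Notation RR := (measurableTypeR R).
Notation mu2 := (mu \x mu)%E.

(** Rotating by - theta turns the lines of direction theta into vertical ones
    and the ray of angle theta into the first axis, and keeps the disc of
    frequencies: the results on vertical lines apply. *)
Lemma line_pt_integral_eq0 (u : R * R -> R) (A theta s : R) :
  continuous u -> mu2.-integrable setT (EFin \o (u : RR * RR -> R)) -> 0 <= A ->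
  (forall xi, A ^+ 2 < xi.1 ^+ 2 + xi.2 ^+ 2 -> no_freq u xi) ->
  (forall r, no_freq u (polar r theta)) ->
  mu.-integrable setT (EFin \o (fun t => u (line_pt theta s t))) /\
  \int[mu]_t u (line_pt theta s t) = 0.
Proof.
move=> cu ui A0 far ray.
pose v := u \o rigid (- theta) 0.
have vE t : u (line_pt theta s t) = v (s, t).
  rewrite /v /rigid/= subr0; congr u.
  by rewrite /line_pt /rot2/= cosN sinN; congr pair; ring.
have vi : mu2.-integrable setT (EFin \o (v : RR * RR -> R)).
  exact: preserves_integrable (preserves_rigid (- theta) 0) ui.
have cv : continuous v.
  by move=> x; apply: continuous_comp; [exact: continuous_rigid|exact: cu].
have vfreq xi : no_freq u (rot2 (- theta) xi) -> no_freq v xi.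
  by move=> /(no_freq_rigid (- theta) 0 ui); rewrite rot2K.
have band a b : A < `|a| -> no_freq v (a, b).
  move=> Aa; apply: vfreq; apply: far; rewrite normsq_rot2/=.
  rewrite (@lt_le_trans _ _ (a ^+ 2)) ?lerDl ?sqr_ge0//.
  by rewrite -[ltRHS]real_normK ?num_real// ltrXn2r.
have line0 a : no_freq v (a, 0).
  apply: vfreq; rewrite (_ : rot2 _ _ = polar a theta) //.
  by rewrite /rot2 /polar/= cosN sinN; congr pair; ring.
have -> : (fun t => u (line_pt theta s t)) = (fun t => v (s, t)) by apply/funext.
split; first exact: (integrable_section vi cv A0 band).
exact: (line_integral_eq0 vi cv A0 band line0).
Qed.

Lemma limited_radon_eq0_of_fourier (Phi A : R) (f : R * R -> R[i]) :
  continuous (fun x => complex.Re (f x)) -> continuous (fun x => complex.Im (f x)) ->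
  cintegrable (@lebesgue2 R) f -> 0 <= A ->
  (forall xi, A ^+ 2 < xi.1 ^+ 2 + xi.2 ^+ 2 ->
     no_freq (fun x => complex.Re (f x)) xi /\
     no_freq (fun x => complex.Im (f x)) xi) ->
  (forall xi, wedge Phi xi -> fourier f xi = 0) ->
  limited_radon_eq0 Phi f.
Proof.
move=> cre cim fi A0 far fw theta s thPhi.
(* The wedge is symmetric, since its radial coordinate takes both signs. *)
have ray r : no_freq (fun x => complex.Re (f x)) (polar r theta) /\
             no_freq (fun x => complex.Im (f x)) (polar r theta).
  have th : `|theta| <= Phi by rewrite ler_norml; move: thPhi; rewrite in_itv.
  apply: fourier0_no_freq => //; apply: fw; first by exists r, theta.
  by exists (- r), theta; split => //; rewrite /polar !mulNr.
have [ri ii] := fi.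
have [ir r0] := line_pt_integral_eq0 s cre ri A0
  (fun xi h => (far xi h).1) (fun r => (ray r).1).
have [iI i0] := line_pt_integral_eq0 s cim ii A0
  (fun xi h => (far xi h).2) (fun r => (ray r).2).
by split; [split|rewrite /radon /cintegral r0 i0].
Qed.

Lemma supp1_eq0 (f : R -> R) (D : set R) (x : R) : supp1 f `<=` D -> ~ D x -> f x = 0.
Proof.
move=> fD nDx; apply/eqP; apply: contrapT => /negP fx; apply: nDx; apply: fD.
by apply: subset_closure.
Qed.

Lemma invisible_fourier0 (psi_low : R * R -> R[i]) psi_gen (Phi : R) i xi :
  invisible_index psi_low psi_gen Phi i -> wedge Phi xi ->
  fourier (curvelet psi_low psi_gen i) xi = 0.
Proof.
move=> [_ inv] wxi; apply/eqP; apply: contrapT => /negP fx.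
have : (supp2 (fourier (curvelet psi_low psi_gen i)) `&` wedge Phi) xi.
  by split => //; apply: subset_closure.
by rewrite inv.
Qed.

Lemma generating_curvelet_far (W V : R -> R) j (psi : R * R -> R[i]) xi :
  radial_window W -> is_generating_curvelet W V j psi ->
  (2 ^+ j.+1) ^+ 2 <= xi.1 ^+ 2 + xi.2 ^+ 2 -> fourier psi xi = 0.
Proof.
move=> [_ sW _] [_ _ _ fpsi].
have [r [omega [r0 om ->]]] := polar_coordinates xi.
rewrite /polar/= !exprMn -mulrDr cos2Dsin2 mulr1 => rj.
rewrite fpsi// /curvelet_profile (supp1_eq0 (x := 2 ^- j * r) sW) ?mulr0 ?mul0r//.
rewrite /= in_itv/= => /andP[_]; rewrite ltNge => /negP; apply.
rewrite ler_pdivlMl ?exprn_gt0// -exprSr.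
by move: rj; rewrite ler_pXn2r ?nnegrE// exprn_ge0.
Qed.

Lemma lowpass_window0 (W W0 : R -> R) :
  radial_window W -> lowpass_window W W0 -> W0 0 != 0.
Proof.
move=> [_ sW _] /(_ 0 (lexx _)) H; apply/eqP => W00; move: H.
have -> : W0 0 ^+ 2 = 0 by rewrite W00 expr0n.
rewrite eseries0; last first.
  move=> n _ _; rewrite mulr0 (supp1_eq0 (x := 0) sW) ?expr0n//.
  by rewrite /= in_itv/= => /andP[h _]; move: h; rewrite ltNge invr_ge0 ler0n.
by move=> /(congr1 fine) /= /eqP; rewrite oppr0 addr0 eq_sym oner_eq0.
Qed.

Lemma fourier_translate0 (f : R * R -> R[i]) (b : R * R) :
  cintegrable (@lebesgue2 R) f ->
  fourier (fun x => f (x - b)) 0 = fourier f 0.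
Proof.
move=> [ri ii]; rewrite /fourier /cintegral.
have E g x : g * cexpi (- dot2 x 0) = g :> R[i].
  by rewrite /dot2/= !mulr0 addr0 oppr0 /cexpi cos0 sin0 -[RHS]mulr1.
congr (_ * (_ +i* _)).
  under eq_Rintegral do rewrite E.
  under [RHS]eq_Rintegral do rewrite E.
  exact: (preserves_integral (preserves_translation2 b) ri).
under eq_Rintegral do rewrite E.
under [RHS]eq_Rintegral do rewrite E.
exact: (preserves_integral (preserves_translation2 b) ii).
Qed.

(** The frequency 0 lies in the wedge, and translating a function does not
    change its transform there. *)
Lemma lowpass_visible (W W0 : R -> R) (psi_low : R * R -> R[i]) psi_gen
    (Phi : R) m l k :
  radial_window W -> lowpass_window W W0 ->
  is_lowpass_function W0 psi_low -> 0 <= Phi ->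
  ~ invisible_index psi_low psi_gen Phi (Negz m, l, k).
Proof.
move=> hW hW0 [_ _ li lf] P0 /invisible_fourier0 inv.
have p0 : polar 0 0 = 0 :> R * R by rewrite /polar !mul0r.
have : wedge Phi (0 : R * R) by exists 0, 0; rewrite normr0 p0.
move/inv; rewrite fourier_translate0// -p0 lf//; last first.
  by rewrite in_itv/= oppr_le0 pi_ge0 pi_gt0.
by move=> [] /eqP; rewrite (negbTE (lowpass_window0 hW hW0)).
Qed.
End Invisible.

Theorem theorem4p1 (R : realType) (W V W0 : R -> R)
    (psi_low : R * R -> R[i]) (psi_gen : nat -> R * R -> R[i]) (Phi : R)
    (hW : radial_window W) (hV : angular_window V)
    (hW0 : lowpass_window W W0)
    (hgen : forall j : nat, is_generating_curvelet W V j (psi_gen j))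
    (hlow : is_lowpass_function W0 psi_low)
    (hPhi : 0 < Phi < pi / 2) :
  invisible_index psi_low psi_gen Phi `<` curvelet_index /\
  forall (j l : int) (k : int * int),
    invisible_index psi_low psi_gen Phi (j, l, k) ->
    limited_radon_eq0 Phi (curvelet psi_low psi_gen (j, l, k)).
Proof.
have /andP[/ltW P0 _] := hPhi.
have vis m l k := @lowpass_visible R W W0 psi_low psi_gen Phi m l k hW hW0 hlow P0.
split.
  split; first by move=> i [].
  by move=> /(_ (Negz 0, 0, (0, 0)) (conj erefl erefl)); exact: vis.
move=> [j|m] l k inv; last by case: (vis m l k inv).
have gj := hgen j.
have [cre cim pi_ _] := gj.
set T := rigid (curvelet_angle R j l) (curvelet_center R j l k).
have cT : continuous T := @continuous_rigid R _ _.
(* W vanishes on [2, +oo[, hence the radial profile W (2 ^- j * r) for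
   2 ^+ j.+1 <= r. *)
apply: (limited_radon_eq0_of_fourier (A := 2 ^+ j.+1)).
- move=> x; exact: (@continuous_comp _ _ _ T
    (fun x => complex.Re (psi_gen j x)) x (cT x) (cre _)).
- move=> x; exact: (@continuous_comp _ _ _ T
    (fun x => complex.Im (psi_gen j x)) x (cT x) (cim _)).
- case: pi_ => ri ii; split.
    exact: (preserves_integrable (preserves_rigid _ _) ri).
  exact: (preserves_integrable (preserves_rigid _ _) ii).
- exact: exprn_ge0.
- move=> xi far.
  pose eta := rot2 (curvelet_angle R j l) xi.
  have [nr ni] : no_freq (fun x => complex.Re (psi_gen j x)) eta /\
      no_freq (fun x => complex.Im (psi_gen j x)) eta.
    apply: fourier0_no_freq => //; apply: (generating_curvelet_far hW gj).
      by rewrite normsq_rot2 ltW.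
    by rewrite /= !sqrrN normsq_rot2 ltW.
  case: pi_ => ri ii; rewrite -(rot2K (curvelet_angle R j l) xi); split.
    exact: (no_freq_rigid _ _ ri nr).
  exact: (no_freq_rigid _ _ ii ni).
- by move=> xi; exact: invisible_fourier0 inv.
Qed.
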